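(* $\mathsf{RCA}_0$ proves the following (a version of Caristi's fixed point theorem): consider a continuous function $f\colon\mathbb R\to\mathbb R$ and a lower semi-continuous function $g\colon\mathbb R\to[0,\infty)$, represented by a family of rationals $g_i(q)\geq 0$ as described in the context. If $g(f(x))\leq g(x)-|x-f(x)|$ holds for all $x\in\mathbb R$, then $f$ has a fixed point, i.e., there is a real $x$ with $f(x)=x$.
   Context: $\mathsf{RCA}_0$ is the usual base system of second-order arithmetic (basic arithmetic axioms, $\Sigma^0_1$-induction, $\Delta^0_1$-comprehension). Reals. A real is a Cauchy sequence $x=(x_n)_{n\in\mathbb N}$ of rationals with no rate of convergence given: for each rational $\varepsilon>0$ there is an $N\in\mathbb N$ with $|x_m-x_n|<\varepsilon$ for all $m,n\geq N$. For reals $x,y$: $x\leq y$ means that for each rational $\varepsilon>0$ there is an $N$ with $x_n\leq y_n+\varepsilon$ for all $n\geq N$; $x=y$ means $x\leq y$ and $y\leq x$; $x<y$ means $x\leq y$ but not $x=y$. Addition, multiplication and absolute value are defined pointwise; rationals are identified with constant sequences. Put $B_\delta(y)=\{z\in\mathbb R:|y-z|<\delta\}$. Continuous functions. A partial continuous function on $\mathbb R$ is (represented by) an arbitrary function $f\colon\mathbb Q\to\mathbb Q^{\mathbb N}$, $f(q)=(f(q)_i)_{i\in\mathbb N}$. A real $x$ lies in $\operatorname{dom}(f)$ if each $\varepsilon>0$ admits a (positive) $N\in\mathbb N$ such that $|f(q)_i-f(r)_j|<\varepsilon$ for all rationals $q,r\in B_{1/N}(x)$ and all $i,j\geq N$.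 For $x=(x_i)\in\operatorname{dom}(f)$ the value is the real $f(x)=(f(x_i)_i)_{i\in\mathbb N}$. A continuous function $f\colon\mathbb R\to\mathbb R$ is such an $f$ with $\operatorname{dom}(f)=\mathbb R$. Lower semi-continuous functions. Such a $g$ is represented by an arbitrary family of rationals $g_i(q)\geq 0$ indexed by $i\in\mathbb N$ and $q\in\mathbb Q$. In a sufficiently strong metatheory, it induces the function $g\colon\mathbb R\to[0,\infty]$ with $g(x)=\sup_{n\in\mathbb N}\hat g_n(x)$ for $\hat g_n(x)=\inf\{g_i(p):i\in\mathbb N\text{ and }p\in B_{2^{-n}}(x)\cap\mathbb Q\}$. In $\mathsf{RCA}_0$ the values $g(x)$ need not exist as reals, so statements about them are read as abbreviations. That $g$ maps into $[0,\infty)$ means that for each real $x$ there is a rational $b$ such that for all $n$ there are $i\in\mathbb N$ and a rational $p\in B_{2^{-n}}(x)$ with $g_i(p)\leq b$. With $g'_k(r)=\min_{i\leq k}g_i(r)$, for reals $x,y,z$ the inequality $g(x)\leq g(y)+z$ abbreviates $$\forall\varepsilon>0\;\forall m\;\exists n\;\forall j\;\forall q\in B_{2^{-n}}(y)\;\exists i\;\exists p\in B_{2^{-m}}(x):\; g'_i(p)\leq g'_j(q)+z+\varepsilon,$$ where $m,n,i,j$ range over $\mathbb N$ and $\varepsilon,p,q$ over $\mathbb Q$. The hypothesis $g(f(x))\leq g(x)-|x-f(x)|$ is the instance of this abbreviation with $f(x)$ in place of $x$, $x$ in place of $y$, and $z=-|x-f(x)|$. *)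

(* Defs.v *)
From Stdlib Require Import List.

(** * The language of second-order arithmetic

    De Bruijn indices, one family for number variables and one for set
    variables.  The primitive connectives are [Fbot], [Fimp] and the two
    universal quantifiers; the others are the usual classical
    abbreviations. *)

Inductive term : Type :=
| Tvar (i : nat)
| Tzero
| Tone
| Tadd (s t : term)
| Tmul (s t : term).

Inductive form : Type :=
| Feq (s t : term)
| Flt (s t : term)
| Fmem (t : term) (X : nat)
| Fbot
| Fimp (A B : form)
| Fall (A : form)
| FAll (A : form).

Definition Fneg (A : form) : form := Fimp A Fbot.
Definition For (A B : form) : form := Fimp (Fneg A) B.
Definition Fand (A B : form) : form := Fneg (Fimp A (Fneg B)).
Definition Fiff (A B : form) : form := Fand (Fimp A B) (Fimp B A).
Definition Fex (A : form) : form := Fneg (Fall (Fneg A)).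
Definition FEx (A : form) : form := Fneg (FAll (Fneg A)).

Fixpoint tsubst (s : nat -> term) (t : term) : term :=
  match t with
  | Tvar i => s i
  | Tzero => Tzero
  | Tone => Tone
  | Tadd t u => Tadd (tsubst s t) (tsubst s u)
  | Tmul t u => Tmul (tsubst s t) (tsubst s u)
  end.

Definition tshift : term -> term := tsubst (fun i => Tvar (S i)).

Definition up1 (s : nat -> term) (i : nat) : term :=
  match i with 0 => Tvar 0 | S i => tshift (s i) end.

Definition up2 (r : nat -> nat) (i : nat) : nat :=
  match i with 0 => 0 | S i => S (r i) end.

(** Simultaneous capture-avoiding substitution: [s] for the number variables
    (by terms), [r] for the set variables (by set variables). *)
Fixpoint fsubst (s : nat -> term) (r : nat -> nat) (A : form) : form :=
  match A with
  | Feq t u => Feq (tsubst s t) (tsubst s u)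
  | Flt t u => Flt (tsubst s t) (tsubst s u)
  | Fmem t X => Fmem (tsubst s t) (r X)
  | Fbot => Fbot
  | Fimp A B => Fimp (fsubst s r A) (fsubst s r B)
  | Fall A => Fall (fsubst (up1 s) r A)
  | FAll A => FAll (fsubst s (up2 r) A)
  end.

Definition shift1 : form -> form := fsubst (fun i => Tvar (S i)) (fun X => X).
Definition shift2 : form -> form := fsubst Tvar S.

Definition inst1 (t : term) : form -> form :=
  fsubst (fun i => match i with 0 => t | S i => Tvar i end) (fun X => X).

Definition inst2 (Y : nat) : form -> form :=
  fsubst Tvar (fun X => match X with 0 => Y | S X => X end).

(** * Provability

    Classical two-sorted natural deduction with equality.  [prv T G A] is
    derivability of [A] from the hypotheses [G] and the axioms [T].  As [p_ax]
    is available under any hypotheses, in particular with no variable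
    condition on the quantifier rules, the free variables of an axiom are
    read as universally quantified. *)

Inductive prv (T : form -> Prop) : list form -> form -> Prop :=
| p_ax G A : T A -> prv T G A
| p_hyp G A : In A G -> prv T G A
| p_impI G A B : prv T (A :: G) B -> prv T G (Fimp A B)
| p_impE G A B : prv T G (Fimp A B) -> prv T G A -> prv T G B
| p_raa G A : prv T (Fneg A :: G) Fbot -> prv T G A
| p_all1I G A : prv T (map shift1 G) A -> prv T G (Fall A)
| p_all1E G A t : prv T G (Fall A) -> prv T G (inst1 t A)
| p_all2I G A : prv T (map shift2 G) A -> prv T G (FAll A)
| p_all2E G A Y : prv T G (FAll A) -> prv T G (inst2 Y A)
| p_eqI G t : prv T G (Feq t t)
| p_eqE G A s t : prv T G (Feq s t) -> prv T G (inst1 s A) -> prv T G (inst1 t A).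

Definition provable (T : form -> Prop) (A : form) : Prop := prv T nil A.

(** * The theory RCA_0 *)

(** Bounded quantifiers [n < t]: the bound [t] lives outside the scope of [n].
    The bounded existential quantifier is the abbreviation [~ forall n < t, ~]. *)
Inductive Delta00 : form -> Prop :=
| D_eq s t : Delta00 (Feq s t)
| D_lt s t : Delta00 (Flt s t)
| D_mem t X : Delta00 (Fmem t X)
| D_bot : Delta00 Fbot
| D_imp A B : Delta00 A -> Delta00 B -> Delta00 (Fimp A B)
| D_ball t A : Delta00 A -> Delta00 (Fall (Fimp (Flt (Tvar 0) (tshift t)) A)).

Inductive Sigma01 : form -> Prop :=
| Sigma01_intro A : Delta00 A -> Sigma01 (Fex A).

Inductive Pi01 : form -> Prop :=
| Pi01_intro A : Delta00 A -> Pi01 (Fall A).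

(** In the two schemes the distinguished number variable is [Tvar 0]; all
    other free variables are parameters. *)

Definition induction_axiom (A : form) : form :=
  Fimp (inst1 Tzero A)
    (Fimp (Fall (Fimp A
             (fsubst (fun i => match i with
                               | 0 => Tadd (Tvar 0) Tone
                               | S i => Tvar (S i)
                               end) (fun X => X) A)))
       (Fall A)).

Definition comprehension_axiom (A B : form) : form :=
  Fimp (Fall (Fiff A B))
    (FEx (Fall (Fiff (Fmem (Tvar 0) 0) (shift2 A)))).

Inductive RCA0 : form -> Prop :=
| ax_succ_neq_0 :
    RCA0 (Fneg (Feq (Tadd (Tvar 0) Tone) Tzero))
| ax_succ_inj :
    RCA0 (Fimp (Feq (Tadd (Tvar 0) Tone) (Tadd (Tvar 1) Tone))
               (Feq (Tvar 0) (Tvar 1)))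
| ax_add_0 :
    RCA0 (Feq (Tadd (Tvar 0) Tzero) (Tvar 0))
| ax_add_succ :
    RCA0 (Feq (Tadd (Tvar 0) (Tadd (Tvar 1) Tone))
              (Tadd (Tadd (Tvar 0) (Tvar 1)) Tone))
| ax_mul_0 :
    RCA0 (Feq (Tmul (Tvar 0) Tzero) Tzero)
| ax_mul_succ :
    RCA0 (Feq (Tmul (Tvar 0) (Tadd (Tvar 1) Tone))
              (Tadd (Tmul (Tvar 0) (Tvar 1)) (Tvar 0)))
| ax_not_lt_0 :
    RCA0 (Fneg (Flt (Tvar 0) Tzero))
| ax_lt_succ :
    RCA0 (Fiff (Flt (Tvar 0) (Tadd (Tvar 1) Tone))
               (For (Flt (Tvar 0) (Tvar 1)) (Feq (Tvar 0) (Tvar 1))))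
| ax_Sigma01_induction A :
    Sigma01 A -> RCA0 (induction_axiom A)
| ax_Delta01_comprehension A B :
    Sigma01 A -> Pi01 B -> RCA0 (comprehension_axiom A B).

(** * Writing formulas

    To write formulas with named bound variables, terms, set variables and
    formulas are given as functions of the current numbers [d] and [e] of
    enclosing number and set quantifiers.  The variable bound by the
    quantifier at depth [d0] has index [d - S d0] when it occurs at
    depth [d]. *)

Definition nexp : Type := nat -> term.
Definition sexp : Type := nat -> nat.
Definition fexp : Type := nat -> nat -> form.

Definition sentence (P : fexp) : form := P 0 0.

Definition nzero : nexp := fun _ => Tzero.
Definition none : nexp := fun _ => Tone.
Definition nadd (s t : nexp) : nexp := fun d => Tadd (s d) (t d).
Definition nmul (s t : nexp) : nexp := fun d => Tmul (s d) (t d).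

Definition feq (s t : nexp) : fexp := fun d _ => Feq (s d) (t d).
Definition flt (s t : nexp) : fexp := fun d _ => Flt (s d) (t d).
Definition fmem (t : nexp) (X : sexp) : fexp := fun d e => Fmem (t d) (X e).
Definition fneg (P : fexp) : fexp := fun d e => Fneg (P d e).
Definition fimp (P Q : fexp) : fexp := fun d e => Fimp (P d e) (Q d e).
Definition fand (P Q : fexp) : fexp := fun d e => Fand (P d e) (Q d e).
Definition for_ (P Q : fexp) : fexp := fun d e => For (P d e) (Q d e).

Definition all1 (P : nexp -> fexp) : fexp :=
  fun d e => Fall (P (fun d' => Tvar (d' - S d)) (S d) e).
Definition ex1 (P : nexp -> fexp) : fexp :=
  fun d e => Fex (P (fun d' => Tvar (d' - S d)) (S d) e).
Definition all2 (P : sexp -> fexp) : fexp :=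
  fun d e => FAll (P (fun e' => e' - S e) d (S e)).
Definition ex2 (P : sexp -> fexp) : fexp :=
  fun d e => FEx (P (fun e' => e' - S e) d (S e)).

Declare Scope so_scope.
Delimit Scope so_scope with SO.

Notation "s + t" := (nadd s t) : so_scope.
Notation "s * t" := (nmul s t) : so_scope.
Notation "0" := nzero : so_scope.
Notation "1" := none : so_scope.
Notation "s = t" := (feq s t) : so_scope.
Notation "s < t" := (flt s t) : so_scope.
Notation "t 'IN' X" := (fmem t X) (at level 70) : so_scope.
Notation "~ P" := (fneg P) : so_scope.
Notation "P /\ Q" := (fand P Q) : so_scope.
Notation "P \/ Q" := (for_ P Q) : so_scope.
Notation "P ==> Q" := (fimp P Q) (at level 90, right associativity) : so_scope.
Notation "'ALL' x .. y , P" := (all1 (fun x => .. (all1 (fun y => P)) ..))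
  (at level 200, x binder, y binder, right associativity) : so_scope.
Notation "'EX' x .. y , P" := (ex1 (fun x => .. (ex1 (fun y => P)) ..))
  (at level 200, x binder, y binder, right associativity) : so_scope.
Notation "'ALLSET' X .. Y , P" := (all2 (fun X => .. (all2 (fun Y => P)) ..))
  (at level 200, X binder, Y binder, right associativity) : so_scope.
Notation "'EXSET' X .. Y , P" := (ex2 (fun X => .. (ex2 (fun Y => P)) ..))
  (at level 200, X binder, Y binder, right associativity) : so_scope.

Local Open Scope so_scope.

Definition nle (s t : nexp) : fexp := s < t \/ s = t.
Notation "s <= t" := (nle s t) : so_scope.

Definition npair (s t : nexp) : nexp := (s + t) * (s + t) + s.

(** * Rational numbers *)

(** [Rat a b c] stands for the rational [(a - b) / c], where [c > 0]. *)
Record qexp : Type := Rat { qpos : nexp; qneg : nexp; qden : nexp }.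

Definition qcode (q : qexp) : nexp := npair (npair (qpos q) (qneg q)) (qden q).

(** Lowest terms.  Quantifiers over rationals range over these triples, so
    that each rational has exactly one code and a set of pairs of codes can be
    a function on the rationals. *)
Definition canonical (q : qexp) : fexp :=
  0 < qden q /\ (qpos q = 0 \/ qneg q = 0) /\
  (ALL u v w, qpos q + qneg q = u * w /\ qden q = v * w ==> w = 1).

Definition allQ (P : qexp -> fexp) : fexp :=
  ALL a b c, canonical (Rat a b c) ==> P (Rat a b c).
Definition exQ (P : qexp -> fexp) : fexp :=
  EX a b c, canonical (Rat a b c) /\ P (Rat a b c).

Notation "'ALLQ' x .. y , P" := (allQ (fun x => .. (allQ (fun y => P)) ..))
  (at level 200, x binder, y binder, right associativity) : so_scope.
Notation "'EXQ' x .. y , P" := (exQ (fun x => .. (exQ (fun y => P)) ..))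
  (at level 200, x binder, y binder, right associativity) : so_scope.

Definition q0 : qexp := Rat 0 0 1.
Definition qinv (n : nexp) : qexp := Rat 1 0 n.
Definition qopp (q : qexp) : qexp := Rat (qneg q) (qpos q) (qden q).
Definition qadd (q r : qexp) : qexp :=
  Rat (qpos q * qden r + qpos r * qden q)
      (qneg q * qden r + qneg r * qden q)
      (qden q * qden r).

Definition qeq (q r : qexp) : fexp :=
  qpos q * qden r + qneg r * qden q = qpos r * qden q + qneg q * qden r.
Definition qlt (q r : qexp) : fexp :=
  qpos q * qden r + qneg r * qden q < qpos r * qden q + qneg q * qden r.
Definition qle (q r : qexp) : fexp :=
  qpos q * qden r + qneg r * qden q <= qpos r * qden q + qneg q * qden r.

Notation "q =Q r" := (qeq q r) (at level 70) : so_scope.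
Notation "q <Q r" := (qlt q r) (at level 70) : so_scope.
Notation "q <=Q r" := (qle q r) (at level 70) : so_scope.
Notation "q +Q r" := (qadd q r) (at level 50, left associativity) : so_scope.
Notation "q -Q r" := (qadd q (qopp r)) (at level 50, left associativity) : so_scope.

(** [qabs q P] is the statement [P |q|]. *)
Definition qabs (q : qexp) (P : qexp -> fexp) : fexp :=
  (q0 <=Q q ==> P q) /\ (q <Q q0 ==> P (qopp q)).

Definition exuniqueQ (P : qexp -> fexp) : fexp :=
  EXQ q, P q /\ (ALLQ r, P r ==> r =Q q).

(** * Real numbers *)

(** A sequence of rationals is given by its graph, a formula in [n] and [q]
    saying that the [n]-th entry is [q].  The graph of a pointwise operation
    is defined from those of its arguments, so that [x - f(x)] can be written
    without asserting that it exists as a set. *)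
Definition rexp : Type := nexp -> qexp -> fexp.

Definition rset (X : sexp) : rexp := fun n q => npair n (qcode q) IN X.
Definition rconst (q : qexp) : rexp := fun _ r => r =Q q.
Definition radd (x y : rexp) : rexp :=
  fun n r => EXQ a b, x n a /\ y n b /\ r =Q a +Q b.
Definition ropp (x : rexp) : rexp := fun n r => EXQ a, x n a /\ r =Q qopp a.
Definition rabs (x : rexp) : rexp :=
  fun n r => EXQ a, x n a /\ qabs a (fun s => r =Q s).

Definition rle (x y : rexp) : fexp :=
  ALLQ eps, q0 <Q eps ==>
    EX N, ALL n, N <= n ==> EXQ a b, x n a /\ y n b /\ a <=Q b +Q eps.
Definition req (x y : rexp) : fexp := rle x y /\ rle y x.
Definition rlt (x y : rexp) : fexp := rle x y /\ ~ req x y.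

Notation "x +R y" := (radd x y) (at level 50, left associativity) : so_scope.
Notation "x -R y" := (radd x (ropp y)) (at level 50, left associativity) : so_scope.
Notation "-R x" := (ropp x) (at level 35, right associativity) : so_scope.
Notation "x <=R y" := (rle x y) (at level 70) : so_scope.
Notation "x =R y" := (req x y) (at level 70) : so_scope.
Notation "x <R y" := (rlt x y) (at level 70) : so_scope.

(** [X] is a function from the natural numbers to the rationals. *)
Definition is_seq (X : sexp) : fexp :=
  (ALL k, k IN X ==> EX n, EXQ q, k = npair n (qcode q)) /\
  (ALL n, exuniqueQ (fun q => npair n (qcode q) IN X)).

Definition is_real (X : sexp) : fexp :=
  is_seq X /\
  (ALLQ eps, q0 <Q eps ==>
    EX N, ALL m n, N <= m ==> N <= n ==>
      EXQ a b, rset X m a /\ rset X n b /\ qabs (a -Q b) (fun s => s <Q eps)).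

Definition allR (P : rexp -> fexp) : fexp := ALLSET X, is_real X ==> P (rset X).
Definition exR (P : rexp -> fexp) : fexp := EXSET X, is_real X /\ P (rset X).

Notation "'ALLR' x .. y , P" := (allR (fun x => .. (allR (fun y => P)) ..))
  (at level 200, x binder, y binder, right associativity) : so_scope.
Notation "'EXR' x .. y , P" := (exR (fun x => .. (exR (fun y => P)) ..))
  (at level 200, x binder, y binder, right associativity) : so_scope.

(** The rational [p] lies in the ball with radius [delta] around [y]. *)
Definition ball (delta : qexp) (y : rexp) (p : qexp) : fexp :=
  rabs (y -R rconst p) <R rconst delta.

(** * Continuous functions *)

(** [r] is the rational [f(q)_i]. *)
Definition fval (F : sexp) (q : qexp) (i : nexp) (r : qexp) : fexp :=
  npair (npair (qcode q) i) (qcode r) IN F.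

Definition is_pfun (F : sexp) : fexp :=
  (ALL k, k IN F ==> EXQ q, EX i, EXQ r,
     k = npair (npair (qcode q) i) (qcode r)) /\
  (ALLQ q, ALL i, exuniqueQ (fun r => fval F q i r)).

Definition in_dom (F : sexp) (x : rexp) : fexp :=
  ALLQ eps, q0 <Q eps ==>
    EX N, 0 < N /\
      ALLQ q r, ball (qinv N) x q ==> ball (qinv N) x r ==>
        ALL i j, N <= i ==> N <= j ==>
          EXQ a b, fval F q i a /\ fval F r j b /\
                   qabs (a -Q b) (fun s => s <Q eps).

Definition fapp (F : sexp) (x : rexp) : rexp :=
  fun i r => EXQ q, x i q /\ fval F q i r.

Definition continuous_on_R (F : sexp) : fexp :=
  is_pfun F /\ ALLR x, in_dom F x.

(** * Lower semi-continuous functions *)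

(** [v = 2 ^ n], via the function defined by primitive recursion. *)
Definition pow2 (n v : nexp) : fexp :=
  EXSET E,
    (ALL k, k IN E ==> EX m w, k = npair m w) /\
    (ALL m, EX w, npair m w IN E /\ (ALL w', npair m w' IN E ==> w' = w)) /\
    npair 0 1 IN E /\
    (ALL m w, npair m w IN E ==> npair (m + 1) (w * (1 + 1)) IN E) /\
    npair n v IN E.

(** [p] lies in the ball with radius [2 ^ (-n)] around [x]. *)
Definition ball2 (n : nexp) (x : rexp) (p : qexp) : fexp :=
  EX v, pow2 n v /\ ball (qinv v) x p.

(** [r] is the rational [g_i(q)]. *)
Definition gval (G : sexp) (i : nexp) (q r : qexp) : fexp :=
  npair (npair i (qcode q)) (qcode r) IN G.

Definition is_lsc (G : sexp) : fexp :=
  (ALL k, k IN G ==> EX i, EXQ q r,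
     k = npair (npair i (qcode q)) (qcode r)) /\
  (ALL i, ALLQ q, exuniqueQ (fun r => gval G i q r)) /\
  (ALL i, ALLQ q r, gval G i q r ==> q0 <=Q r).

Definition finite_valued (G : sexp) : fexp :=
  ALLR x, EXQ b, ALL n, EX i, EXQ p,
    ball2 n x p /\ EXQ r, gval G i p r /\ r <=Q b.

(** [min_{i <= k} g_i(q)], as a constant sequence. *)
Definition gmin (G : sexp) (k : nexp) (q : qexp) : rexp :=
  fun _ r =>
    (EX i, i <= k /\ gval G i q r) /\
    (ALL i, i <= k ==> ALLQ s, gval G i q s ==> r <=Q s).

(** [g(x) <= g(y) + z] *)
Definition lsc_le (G : sexp) (x y z : rexp) : fexp :=
  ALLQ eps, q0 <Q eps ==> ALL m, EX n, ALL j, ALLQ q, ball2 n y q ==>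
    EX i, EXQ p, ball2 m x p /\
      gmin G i p <=R gmin G j q +R z +R rconst eps.

(* Main.v *)
From HB Require Import structures.
From mathcomp Require all_boot order ssralg ssrnum boolp ring lra.
From Pilot Require Import -(notations) Defs.

(** The derivation is obtained from Goedel's completeness theorem for the
    calculus, so that it suffices to find the fixed point in an arbitrary model
    [M] of [RCA_0], whose natural numbers may be nonstandard.

    Enumerate all triples [(i, p, g_i(p))], each infinitely often, and order them
    by [(i, p, a) < (j, q, b)] iff [a + |p - q| / 2 <= b].  The greedy chain takes
    a triple whenever it is below all triples taken before.  Along the chain
    the values are nonnegative and decreasing, hence form a Cauchy sequence by
    [Sigma^0_1]-induction on the number of steps of size [eps]; therefore the
    points of the chain form a Cauchy sequence as well, with limit [x].  As each
    triple gets a chance after every stage, [a + |p - x| / 2 >= lim b] for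
    all triples [(i, p, a)].  Applied to points [p] near [f(x)], together with
    [g(f(x)) <= g(x) - |x - f(x)| <= lim b - |x - f(x)|], this yields
    [|x - f(x)| <= |x - f(x)| / 2], so that [f(x) = x]. *)

(* The notation [==>] of [Defs] clashes with that of [ssrbool]: the library is
   imported inside this module only. *)
Module Caristi.

Import all_boot order ssralg ssrnum boolp ring lra.
Import Order.TTheory GRing.Theory Num.Theory.
Set Implicit Arguments.
Unset Strict Implicit.
Unset Printing Implicit Defensive.

(** * Completeness of the calculus *)

(** The factor $1/2$ in the order is what closes the argument: with factor $1$ the last step would
    only give $|x - f(x)| \le |x - f(x)|$; any positive factor below $1$ would serve. The values of
    [g] need not exist as reals in the model, so the chain is built from rational data alone, and
    whether a triple is taken is a bounded condition on the triples taken before it. Because a real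
    carries no rate of convergence, bounding the number of large drops already makes the points of
    the chain a real. The limit of the heights is used only through tails, where heights differ by
    at most a given [eps]. Since the model may be nonstandard, each induction inside it comes with a
    proof that its formula is definable. The recursion that produces the chain rests on a coding of
    bounded sets by divisibility, which avoids presupposing exponentiation. *)

Section Quotient.
Variables (T : Type) (e : T -> T -> Prop).
Hypotheses (e_refl : forall x, e x x) (e_sym : forall x y, e x y -> e y x)
  (e_trans : forall x y z, e x y -> e y z -> e x z).

(** Classes are the predicates [e t] themselves, so by extensionality equality in the quotient is
    Leibniz equality. Used for terms modulo provable equality and for fractions. *)
Definition quot := {P : T -> Prop | exists t, P = e t}.
Definition cls (t : T) : quot := exist _ (e t) (ex_intro _ t erefl).
Definition repr (x : quot) : T := projT1 (cid (proj2_sig x)).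

Lemma cls_eq t u : cls t = cls u <-> e t u.
Proof.
split=> [[->] // | tu]; apply: eq_exist; apply/funext => v; apply/propext.
by split=> [/(e_trans (e_sym tu)) | /(e_trans tu)].
Qed.

Lemma reprK x : cls (repr x) = x.
Proof.
by case: x => P h; apply: eq_exist; rewrite /repr /=; case: (cid _).
Qed.

Lemma repr_cls t : e (repr (cls t)) t.
Proof. by apply/cls_eq; rewrite reprK. Qed.

End Quotient.

(** Henkin semantics: the sets form a second sort with an arbitrary membership relation, not
    necessarily extensional. *)
Record model := Model {
  dom : Type;
  sets : Type;
  mzero : dom;
  mone : dom;
  madd : dom -> dom -> dom;
  mmul : dom -> dom -> dom;
  mlt : dom -> dom -> Prop;
  mmem : dom -> sets -> Prop }.

Definition scons (T : Type) (x : T) (f : nat -> T) (i : nat) : T :=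
  match i with 0 => x | S j => f j end.

Fixpoint eval (M : model) (r : nat -> dom M) (t : term) : dom M :=
  match t with
  | Tvar i => r i
  | Tzero => mzero M
  | Tone => mone M
  | Tadd t u => madd (eval r t) (eval r u)
  | Tmul t u => mmul (eval r t) (eval r u)
  end.

Fixpoint sat (M : model) (r : nat -> dom M) (q : nat -> sets M) (A : form)
    : Prop :=
  match A with
  | Feq t u => eval r t = eval r u
  | Flt t u => mlt (eval r t) (eval r u)
  | Fmem t X => mmem (eval r t) (q X)
  | Fbot => False
  | Fimp A B => sat r q A -> sat r q B
  | Fall A => forall x, sat (scons x r) q A
  | FAll A => forall X, sat r (scons X q) A
  end.

Lemma eval_tsubst M (r : nat -> dom M) s t :
  eval r (tsubst s t) = eval (fun i => eval r (s i)) t.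
Proof. by elim: t => //= [t -> u ->|t -> u ->]. Qed.

Lemma eval_tshift M (r : nat -> dom M) x t : eval (scons x r) (tshift t) = eval r t.
Proof. by rewrite eval_tsubst. Qed.

Lemma sat_fsubst M (A : form) : forall (r : nat -> dom M) q s f,
  sat r q (fsubst s f A) =
  sat (fun i => eval r (s i)) (fun X => q (f X)) A.
Proof.
elim: A => //= [t u|t u|t X|A IA B IB|A IA|A IA] r q s f.
- by rewrite !eval_tsubst.
- by rewrite !eval_tsubst.
- by rewrite eval_tsubst.
- by rewrite IA IB.
- apply: eq_forall => x; rewrite IA; congr (sat _ _ _).
  by apply/funext => -[|i] //=; rewrite eval_tshift.
- by apply: eq_forall => X; rewrite IA; congr (sat _ _ _); apply/funext => -[].
Qed.

(** * Substitution and free variables *)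

Lemma tsubst_comp s s' t :
  tsubst s' (tsubst s t) = tsubst (fun i => tsubst s' (s i)) t.
Proof. by elim: t => //= [t -> u ->|t -> u ->]. Qed.

Lemma tsubst_id t : tsubst Tvar t = t.
Proof. by elim: t => //= [t -> u ->|t -> u ->]. Qed.

Lemma up1_id : up1 Tvar = Tvar.
Proof. by apply/funext => -[]. Qed.

Lemma up2_id : up2 id = id.
Proof. by apply/funext => -[]. Qed.

Lemma fsubst_comp A : forall s f s' f',
  fsubst s' f' (fsubst s f A) =
  fsubst (fun i => tsubst s' (s i)) (fun X => f' (f X)) A.
Proof.
elim: A => //= [t u|t u|t X|A IA B IB|A IA|A IA] s f s' f'.
- by rewrite !tsubst_comp.
- by rewrite !tsubst_comp.
- by rewrite tsubst_comp.
- by rewrite IA IB.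
- rewrite IA; congr (Fall (fsubst _ _ _)); apply/funext => -[|i] //=.
  by rewrite /tshift !tsubst_comp.
- by rewrite IA; congr (FAll (fsubst _ _ _)); apply/funext => -[].
Qed.

Lemma fsubst_id A : fsubst Tvar id A = A.
Proof.
elim: A => //= [t u|t u|t X|A IA B IB|A IA|A IA].
- by rewrite !tsubst_id.
- by rewrite !tsubst_id.
- by rewrite tsubst_id.
- by rewrite IA IB.
- by rewrite up1_id IA.
- by rewrite up2_id IA.
Qed.

(** Strict upper bounds for the free indices; variables beyond them will serve as Henkin
    witnesses. *)
Fixpoint tbound (t : term) : nat :=
  match t with
  | Tvar i => i.+1
  | Tzero | Tone => 0
  | Tadd t u | Tmul t u => maxn (tbound t) (tbound u)
  end.

Fixpoint bound1 (A : form) : nat :=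
  match A with
  | Feq t u | Flt t u => maxn (tbound t) (tbound u)
  | Fmem t _ => tbound t
  | Fbot => 0
  | Fimp A B => maxn (bound1 A) (bound1 B)
  | Fall A => (bound1 A).-1
  | FAll A => bound1 A
  end.

Fixpoint bound2 (A : form) : nat :=
  match A with
  | Feq _ _ | Flt _ _ | Fbot => 0
  | Fmem _ X => X.+1
  | Fimp A B => maxn (bound2 A) (bound2 B)
  | Fall A => bound2 A
  | FAll A => (bound2 A).-1
  end.

Lemma eq_tsubst s s' t :
  (forall i, i < tbound t -> s i = s' i) -> tsubst s t = tsubst s' t.
Proof.
elim: t => //= [i ->//|t IT u IU|t IT u IU] h;
by rewrite IT ?IU // => i ?; apply: h; rewrite leq_max; apply/orP; auto.
Qed.

Lemma eq_fsubst A : forall s s' f f',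
  (forall i, i < bound1 A -> s i = s' i) ->
  (forall X, X < bound2 A -> f X = f' X) ->
  fsubst s f A = fsubst s' f' A.
Proof.
elim: A => //= [t u|t u|t X|A IA B IB|A IA|A IA] s s' f f' h1 h2.
- by congr Feq; apply: eq_tsubst => i ?; apply: h1; rewrite leq_max; apply/orP; auto.
- by congr Flt; apply: eq_tsubst => i ?; apply: h1; rewrite leq_max; apply/orP; auto.
- by rewrite (h2 X) // (eq_tsubst h1).
- by congr Fimp; [apply: IA|apply: IB] => i ?; (apply: h1 || apply: h2);
    rewrite leq_max; apply/orP; auto.
- congr Fall; apply: IA => // -[|i] //= li; rewrite h1 //.
  by rewrite -ltnS; case: (bound1 A) li.
- congr FAll; apply: IA => // -[|i] //= li; rewrite h2 //.
  by rewrite -ltnS; case: (bound2 A) li.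
Qed.

(** * Derived rules of the calculus *)

Section Derivations.
Variable T : form -> Prop.
Implicit Types (A B C : form) (G H : list form).

Lemma prv_weak G A : prv T G A -> forall H, List.incl G H -> prv T H A.
Proof.
elim=> {G A} [G A TA|G A GA|G A B _ IH|G A B _ IA _ IB|G A _ IH|G A _ IH
  |G A t _ IH|G A _ IH|G A Y _ IH|G t|G A s t _ I1 _ I2] H GH.
- exact: p_ax.
- exact/p_hyp/GH.
- apply/p_impI/IH => C /= [->|/GH]; by [left|right].
- exact: p_impE (IA _ GH) (IB _ GH).
- apply/p_raa/IH => C /= [->|/GH]; by [left|right].
- by apply/p_all1I/IH/List.incl_map.
- exact/p_all1E/IH.
- by apply/p_all2I/IH/List.incl_map.
- exact/p_all2E/IH.
- exact: p_eqI.
- exact: p_eqE (I1 _ GH) (I2 _ GH).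
Qed.

(** Folding the hypotheses into the formula makes results on derivations without hypotheses, such as
    closure under substitution, available for derivations from [G]. *)
Definition imps G C := foldr Fimp C (rev G).

Lemma prv_imps G C : prv T nil (imps G C) <-> prv T G C.
Proof.
rewrite /imps; split.
- suff main H : prv T H (foldr Fimp C (rev G)) -> prv T (G ++ H) C.
    by move/main; rewrite cats0.
  elim: G C => [|A G IH] C //; rewrite rev_cons -cats1 foldr_cat /= => /IH h.
  apply: (p_impE _ _ A); last by apply: p_hyp; left.
  by apply: (prv_weak h) => B ?; right.
- elim: G C => [|A G IH] C // h; rewrite rev_cons -cats1 foldr_cat /=.
  exact/IH/p_impI.
Qed.

(** Axioms are available under any hypotheses, so a formula derivable from no
    hypotheses can be generalized and then instantiated: this makes such
    formulas closed under substitution. *)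
Fixpoint first_terms (n : nat) (t : nat -> term) : nat -> term :=
  match n with
  | 0 => Tvar
  | n.+1 => scons (t 0) (first_terms n (fun i => t i.+1))
  end.

Lemma first_termsE n : forall t i, i < n -> first_terms n t i = t i.
Proof. by elim: n => // n IH t [|i] //= /IH ->. Qed.

Lemma prv_first_terms n : forall A t,
  prv T nil A -> prv T nil (fsubst (first_terms n t) id A).
Proof.
elim: n => [|n IH] A t hA /=; first by rewrite fsubst_id.
have := p_all1E _ _ _ (t 0) (IH (Fall A) (fun i => t i.+1) (p_all1I _ nil A hA)).
rewrite /inst1 fsubst_comp /=; congr (prv _ _ (fsubst _ _ _)).
by apply/funext => -[|i] //=; rewrite /tshift tsubst_comp tsubst_id.
Qed.

Fixpoint first_sets (n : nat) (f : nat -> nat) : nat -> nat :=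
  match n with
  | 0 => id
  | n.+1 => scons (f 0) (first_sets n (fun i => f i.+1))
  end.

Lemma first_setsE n : forall f i, i < n -> first_sets n f i = f i.
Proof. by elim: n => // n IH f [|i] //= /IH ->. Qed.

Lemma prv_first_sets n : forall A f,
  prv T nil A -> prv T nil (fsubst Tvar (first_sets n f) A).
Proof.
elim: n => [|n IH] A f hA /=; first by rewrite fsubst_id.
have := p_all2E _ _ _ (f 0) (IH (FAll A) (fun i => f i.+1) (p_all2I _ nil A hA)).
rewrite /inst2 fsubst_comp /=; congr (prv _ _ (fsubst _ _ _)).
by apply/funext => -[|i].
Qed.

(** Only finitely many indices are free in [A], and on these [s] and [f] agree with [first_terms]
    and [first_sets]. *)
Lemma prv_subst A s f : prv T nil A -> prv T nil (fsubst s f A).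
Proof.
move=> /(prv_first_terms (bound1 A) s) /(prv_first_sets (bound2 A) f).
rewrite fsubst_comp (@eq_fsubst A _ s _ f) // => i lti.
- by rewrite first_termsE // tsubst_id.
- by rewrite first_setsE.
Qed.

Definition fresh (b : form -> nat) G : nat := foldr (fun A n => maxn (b A) n) 0 G.

Lemma fresh_le b G A : List.In A G -> b A <= fresh b G.
Proof.
elim: G => //= B G IH [->|/IH h]; first exact: leq_maxl.
exact: leq_trans h (leq_maxr _ _).
Qed.

Lemma fsubst_imps s f G C :
  fsubst s f (imps G C) = imps (List.map (fsubst s f) G) (fsubst s f C).
Proof.
elim: G C => [|A G IH] C //.
by rewrite /imps /= !rev_cons -!cats1 !foldr_cat /= -!/(imps _ _) IH.
Qed.

(** The substitution that sends variable [k] to [0] and shifts all others turns the instance of [B]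
    at [k] back into [B], and the hypotheses, in which [k] is fresh, into their shifts. *)
Lemma prv_gen1 G B k :
  (forall A, List.In A G -> bound1 A <= k) -> bound1 B <= k.+1 ->
  prv T G (inst1 (Tvar k) B) -> prv T G (Fall B).
Proof.
move=> hG hB /prv_imps /(prv_subst (fun i => Tvar (if i == k then 0 else i.+1)) id).
rewrite fsubst_imps => /prv_imps h; apply: p_all1I; move: h.
rewrite (_ : List.map _ G = List.map shift1 G); last first.
  apply: List.map_ext_in => A /hG lA; apply: eq_fsubst => // i li.
  by rewrite ltn_eqF // (leq_trans li).
rewrite /inst1 fsubst_comp /= (@eq_fsubst B _ Tvar _ id) ?fsubst_id // => -[|i] /= li.
  by rewrite eqxx.
by rewrite ltn_eqF // -ltnS (leq_trans li).
Qed.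

Lemma prv_gen2 G B k :
  (forall A, List.In A G -> bound2 A <= k) -> bound2 B <= k.+1 ->
  prv T G (inst2 k B) -> prv T G (FAll B).
Proof.
move=> hG hB /prv_imps /(prv_subst Tvar (fun i => if i == k then 0 else i.+1)).
rewrite fsubst_imps => /prv_imps h; apply: p_all2I; move: h.
rewrite (_ : List.map _ G = List.map shift2 G); last first.
  apply: List.map_ext_in => A /hG lA; apply: eq_fsubst => // i li.
  by rewrite ltn_eqF // (leq_trans li).
rewrite /inst2 fsubst_comp /= (@eq_fsubst B _ Tvar _ id) ?fsubst_id // => -[|i] /= li.
  by rewrite eqxx.
by rewrite ltn_eqF // -ltnS (leq_trans li).
Qed.

End Derivations.

(** * Enumeration of the formulas *)

Fixpoint code_term (t : term) : GenTree.tree nat :=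
  match t with
  | Tvar i => GenTree.Leaf i
  | Tzero => GenTree.Node 0 [::]
  | Tone => GenTree.Node 1 [::]
  | Tadd t u => GenTree.Node 2 [:: code_term t; code_term u]
  | Tmul t u => GenTree.Node 3 [:: code_term t; code_term u]
  end.

Fixpoint decode_term (x : GenTree.tree nat) : term :=
  match x with
  | GenTree.Leaf i => Tvar i
  | GenTree.Node 1 _ => Tone
  | GenTree.Node 2 [:: x; y] => Tadd (decode_term x) (decode_term y)
  | GenTree.Node 3 [:: x; y] => Tmul (decode_term x) (decode_term y)
  | _ => Tzero
  end.

Lemma code_termK : cancel code_term decode_term.
Proof. by elim=> //= [t -> u ->|t -> u ->]. Qed.

Fixpoint code_form (A : form) : GenTree.tree nat :=
  match A with
  | Feq t u => GenTree.Node 0 [:: code_term t; code_term u]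
  | Flt t u => GenTree.Node 1 [:: code_term t; code_term u]
  | Fmem t X => GenTree.Node 2 [:: code_term t; GenTree.Leaf X]
  | Fbot => GenTree.Leaf 0
  | Fimp A B => GenTree.Node 3 [:: code_form A; code_form B]
  | Fall A => GenTree.Node 4 [:: code_form A]
  | FAll A => GenTree.Node 5 [:: code_form A]
  end.

Fixpoint decode_form (x : GenTree.tree nat) : form :=
  match x with
  | GenTree.Node 0 [:: x; y] => Feq (decode_term x) (decode_term y)
  | GenTree.Node 1 [:: x; y] => Flt (decode_term x) (decode_term y)
  | GenTree.Node 2 [:: x; GenTree.Leaf X] => Fmem (decode_term x) X
  | GenTree.Node 3 [:: x; y] => Fimp (decode_form x) (decode_form y)
  | GenTree.Node 4 [:: x] => Fall (decode_form x)
  | GenTree.Node 5 [:: x] => FAll (decode_form x)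
  | _ => Fbot
  end.

Lemma code_formK : cancel code_form decode_form.
Proof.
by elim=> //= [t u|t u|t X|A -> B ->|A ->|A ->]; rewrite ?code_termK.
Qed.

Definition enum_form (n : nat) : form :=
  if unpickle n is Some x then decode_form x else Fbot.

Lemma enum_formP A : exists n, enum_form n = A.
Proof. by exists (pickle (code_form A)); rewrite /enum_form pickleK code_formK. Qed.

(** * The Henkin theory and its term model *)

Section Completeness.
Variables (T : form -> Prop) (A0 : form).
Hypothesis A0_unprovable : ~ provable T A0.

Local Notation consistent G := (~ prv T G Fbot).

(** Every stage is a finite list, so a variable beyond its free indices can witness a negated
    universal formula and the language needs no new constants. *)
Definition henkin_step (G : list form) (A : form) : list form :=
  if `[< prv T (A :: G) Fbot >] then G else
  match A with
  | Fimp (Fall B) Fbot =>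
      Fneg (inst1 (Tvar (fresh bound1 (B :: G))) B) :: A :: G
  | Fimp (FAll B) Fbot =>
      Fneg (inst2 (fresh bound2 (B :: G)) B) :: A :: G
  | _ => A :: G
  end.

Lemma henkin_step_incl G A : List.incl G (henkin_step G A).
Proof.
have h C H (K : list form) : List.incl H K -> List.incl H (C :: K).
  by move=> HK B /HK; right.
rewrite /henkin_step; case: asboolP => _; first exact: List.incl_refl.
case: A => [t u|t u|t X||[t u|t u|t X||A B|A|A] [t' u'|t' u'|t' X'||A' B'|A'|A']|A|A] /=;
  (apply/h/h/List.incl_refl || apply/h/List.incl_refl).
Qed.

(** If adding the negated instance led to a contradiction, the instance would be derivable; as its
    variable is fresh, generalization would yield the universal formula whose negation was just
    added consistently. *)
Lemma henkin_step_consistent G A : consistent G -> consistent (henkin_step G A).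
Proof.
have fin B : consistent (Fneg B :: G) -> forall C, (prv T (Fneg B :: G) C -> prv T (Fneg B :: G) B) ->
    consistent (Fneg C :: Fneg B :: G).
  move=> cB C h /p_raa /h h'; apply: cB; apply: p_impE h'; apply: p_hyp; by left.
rewrite /henkin_step; case: asboolP => // cA _.
case: A cA => [t u|t u|t X||[t u|t u|t X||A B|A|A] [t' u'|t' u'|t' X'||A' B'|A'|A']|A|A] // cA.
- apply: fin => // /prv_gen1; apply => [B /= [<-|inB] /=|].
  + by case: (bound1 A) => [|n] //=; rewrite maxn0 leq_max leqnSn.
  + by rewrite leq_max (fresh_le _ inB) orbT.
  + by rewrite /= leqW // leq_maxl.
- apply: fin => // /prv_gen2; apply => [B /= [<-|inB] /=|].
  + by case: (bound2 A) => [|n] //=; rewrite maxn0 leq_max leqnSn.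
  + by rewrite leq_max (fresh_le _ inB) orbT.
  + by rewrite /= leqW // leq_maxl.
Qed.

Fixpoint stage (n : nat) : list form :=
  if n is n.+1 then henkin_step (stage n) (enum_form n) else [:: Fneg A0].

Lemma stage_consistent n : consistent (stage n).
Proof.
elim: n => [/p_raa //|n IH]; exact: henkin_step_consistent.
Qed.

Lemma stage_incl m n : m <= n -> List.incl (stage m) (stage n).
Proof.
elim: n => [|n IH]; first by rewrite leqn0 => /eqP ->.
rewrite leq_eqVlt ltnS => /orP[/eqP -> //|/IH h] A /h; exact: henkin_step_incl.
Qed.

Definition Th (A : form) : Prop := exists n, List.In A (stage n).

Lemma Th_stage G : (forall B, List.In B G -> Th B) -> exists n, List.incl G (stage n).
Proof.
elim: G => [_|A G IH h]; first by exists 0.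
have [m hm] := IH (fun B inB => h B (or_intror inB)).
have [n hn] := h A (or_introl erefl).
exists (maxn m n) => B /= [<-|/hm].
- exact: (stage_incl (leq_maxr m n)).
- exact: (stage_incl (leq_maxl m n)).
Qed.

Lemma Th_consistent G : (forall B, List.In B G -> Th B) -> consistent G.
Proof. by move=> /Th_stage[n hn] h; apply: (@stage_consistent n); apply: (prv_weak h hn). Qed.

Lemma stage_step n : consistent (enum_form n :: stage n) -> List.In (enum_form n) (stage n.+1).
Proof.
move=> /= c; rewrite /henkin_step; case: asboolP => // _.
by case: (enum_form n) => [t u|t u|t X||[t u|t u|t X||A B|A|A] [t' u'|t' u'|t' X'||A' B'|A'|A']|A|A];
  by [left|right; left].
Qed.

(** The stage that treats [A] must accept it: a refutation of [A] from that stage, combined with the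
    derivation of [A] from [G], would refute a finite part of [Th]. *)
Lemma Th_closed G A : (forall B, List.In B G -> Th B) -> prv T G A -> Th A.
Proof.
move=> hG hA; have [n En] := enum_formP A; exists n.+1; rewrite -En.
apply: stage_step; rewrite En => bot.
have /Th_consistent : forall B, List.In B (G ++ stage n) -> Th B; last apply.
  by move=> B /List.in_app_iff [/hG //|?]; exists n.
apply: (p_impE _ _ A).
  by apply: (prv_weak (p_impI _ _ _ _ bot)) => B ?; apply/List.in_app_iff; right.
by apply: (prv_weak hA) => B ?; apply/List.in_app_iff; left.
Qed.

Lemma Th_prv A : prv T nil A -> Th A.
Proof. exact: Th_closed. Qed.

Lemma Th_bot : ~ Th Fbot.
Proof.
by move=> h; apply: (@Th_consistent [:: Fbot]) => [B [<-|]//|]; apply: p_hyp; left.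
Qed.

Lemma Th_neg A : ~ Th A -> Th (Fneg A).
Proof.
have [n <-] := enum_formP A => nA; have [bot|c] := pselect (prv T (enum_form n :: stage n) Fbot).
  by apply: (@Th_closed (stage n)) (p_impI _ _ _ _ bot) => B ?; exists n.
by case: nA; exists n.+1; apply: stage_step.
Qed.

Lemma Th_mp A B : Th (Fimp A B) -> Th A -> Th B.
Proof.
move=> hAB hA; apply: (@Th_closed [:: Fimp A B; A]) => [C [<-|[<-|]]//|].
apply: p_impE (p_hyp _ _ _ _) (p_hyp _ _ _ _); by [left|right; left].
Qed.

Lemma Th_imp A B : Th (Fimp A B) <-> (Th A -> Th B).
Proof.
split=> [|h]; first exact: Th_mp.
have [hA|nA] := pselect (Th A).
  apply: (@Th_closed [:: B]) => [C [<-|//]|]; first exact: h.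
  by apply/p_impI/p_hyp; right; left.
apply: (@Th_closed [:: Fneg A]) => [C [<-|//]|]; first exact: Th_neg.
apply: p_impI; apply: p_raa; apply: p_impE (p_hyp _ _ _ _) (p_hyp _ _ _ _);
 by [right; right; left|right; left].
Qed.

(** If [Fall B] were missing, its negation would belong to [Th], and the step that treats this
    negation also adds a negated instance. *)
Lemma Th_all1 B : Th (Fall B) <-> (forall t, Th (inst1 t B)).
Proof.
split=> [h t|h].
  apply: (@Th_closed [:: Fall B]) => [C [<-|]//|]; apply/p_all1E/p_hyp; by left.
apply: contrapT => /Th_neg hB; have [n En] := enum_formP (Fneg (Fall B)).
have: Th (Fneg (inst1 (Tvar (fresh bound1 (B :: stage n))) B)).
  exists n.+1; rewrite /= /henkin_step; case: asboolP => [bot|_].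
    suff /Th_consistent/(_ bot) [] : forall C, List.In C (enum_form n :: stage n) -> Th C.
    by move=> C [<-|]; [rewrite En|exists n].
  by rewrite En /=; left.
by move=> /Th_mp /(_ (h _)) /Th_bot.
Qed.

Lemma Th_all2 B : Th (FAll B) <-> (forall Y, Th (inst2 Y B)).
Proof.
split=> [h t|h].
  apply: (@Th_closed [:: FAll B]) => [C [<-|]//|]; apply/p_all2E/p_hyp; by left.
apply: contrapT => /Th_neg hB; have [n En] := enum_formP (Fneg (FAll B)).
have: Th (Fneg (inst2 (fresh bound2 (B :: stage n)) B)).
  exists n.+1; rewrite /= /henkin_step; case: asboolP => [bot|_].
    suff /Th_consistent/(_ bot) [] : forall C, List.In C (enum_form n :: stage n) -> Th C.
    by move=> C [<-|]; [rewrite En|exists n].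
  by rewrite En /=; left.
by move=> /Th_mp /(_ (h _)) /Th_bot.
Qed.

Definition teq (t u : term) : Prop := Th (Feq t u).

Lemma teq_refl t : teq t t.
Proof. exact/Th_prv/p_eqI. Qed.

Lemma teq_subst A t u : teq t u -> Th (inst1 t A) -> Th (inst1 u A).
Proof.
move=> tu tA; apply: (@Th_closed [:: Feq t u; inst1 t A]) => [C [<-|[<-|]]//|].
apply: (p_eqE _ _ _ t); apply: p_hyp; by [left|right; left].
Qed.

Lemma inst1_tshift t u : tsubst (fun i => match i with 0 => t | S i => Tvar i end) (tshift u) = u.
Proof. by rewrite /tshift tsubst_comp tsubst_id. Qed.

Lemma teq_sym t u : teq t u -> teq u t.
Proof.
move=> tu; have := @teq_subst (Feq (Tvar 0) (tshift t)) _ _ tu.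
by rewrite /inst1 /= !inst1_tshift; apply; apply: teq_refl.
Qed.

Lemma teq_trans t u v : teq t u -> teq u v -> teq t v.
Proof.
move=> tu uv; have := @teq_subst (Feq (tshift t) (Tvar 0)) _ _ uv.
by rewrite /inst1 /= !inst1_tshift; apply.
Qed.

Lemma teq_add t t' u u' : teq t t' -> teq u u' -> teq (Tadd t u) (Tadd t' u').
Proof.
move=> h1 h2.
have := @teq_subst (Feq (tshift (Tadd t u)) (Tadd (Tvar 0) (tshift u))) _ _ h1.
have := @teq_subst (Feq (tshift (Tadd t u)) (Tadd (tshift t') (Tvar 0))) _ _ h2.
rewrite /inst1 /= !inst1_tshift => k1 k2; apply/k1/k2; exact: teq_refl.
Qed.

Lemma teq_mul t t' u u' : teq t t' -> teq u u' -> teq (Tmul t u) (Tmul t' u').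
Proof.
move=> h1 h2.
have := @teq_subst (Feq (tshift (Tmul t u)) (Tmul (Tvar 0) (tshift u))) _ _ h1.
have := @teq_subst (Feq (tshift (Tmul t u)) (Tmul (tshift t') (Tvar 0))) _ _ h2.
rewrite /inst1 /= !inst1_tshift => k1 k2; apply/k1/k2; exact: teq_refl.
Qed.

Lemma teq_lt t t' u u' : teq t t' -> teq u u' -> Th (Flt t u) -> Th (Flt t' u').
Proof.
move=> h1 h2.
have := @teq_subst (Flt (Tvar 0) (tshift u)) _ _ h1.
have := @teq_subst (Flt (tshift t') (Tvar 0)) _ _ h2.
by rewrite /inst1 /= !inst1_tshift => k1 k2 ?; apply/k1/k2.
Qed.

Lemma teq_mem t t' X : teq t t' -> Th (Fmem t X) -> Th (Fmem t' X).
Proof. exact: (@teq_subst (Fmem (Tvar 0) X)). Qed.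

Local Notation "[ t ]" := (cls teq t) (format "[ t ]").
Local Notation rep := (@repr _ teq).
Let clsE := cls_eq teq_refl teq_sym teq_trans.
Let rep_cls t : teq (rep [t]) t := repr_cls teq_refl teq_sym teq_trans t.

(** The set variables themselves are the sets, since the language has no other set terms. *)
Definition term_model : model :=
  {| dom := quot teq; sets := nat;
     mzero := [Tzero]; mone := [Tone];
     madd x y := [Tadd (rep x) (rep y)];
     mmul x y := [Tmul (rep x) (rep y)];
     mlt x y := Th (Flt (rep x) (rep y));
     mmem x X := Th (Fmem (rep x) X) |}.

Lemma eval_term_model (s : nat -> term) t :
  @eval term_model (fun i => [s i]) t = [tsubst s t].
Proof.
elim: t => //= [t -> u ->|t -> u ->]; apply/clsE.
- apply: teq_add; exact: rep_cls.
- apply: teq_mul; exact: rep_cls.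
Qed.

(** The truth lemma. It ranges over all [s] and [f] because the quantifier cases extend the
    assignment by arbitrary terms and set variables; every assignment is of this form through
    representatives. *)
Lemma sat_term_model A : forall s f,
  @sat term_model (fun i => [s i]) f A <-> Th (fsubst s f A).
Proof.
elim: A => /= [t u|t u|t X||A IA B IB|A IA|A IA] s f.
- rewrite !eval_term_model; exact: clsE.
- rewrite !eval_term_model; split; apply: teq_lt; try exact: rep_cls;
  exact/teq_sym/rep_cls.
- rewrite !eval_term_model; split; apply: teq_mem; try exact: rep_cls;
  exact/teq_sym/rep_cls.
- by split=> // /Th_bot.
- by rewrite Th_imp IA IB.
- rewrite Th_all1 /inst1.
  have E t : scons [t] (fun i => [s i]) = fun i =>
      [tsubst (fun j => match j with 0 => t | S i0 => Tvar i0 end) (up1 s i)].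
    by apply/funext => -[|i] //=; rewrite inst1_tshift.
  split=> h t; first by rewrite fsubst_comp; apply/IA; rewrite -E; apply: h.
  by rewrite -(reprK t) E; apply/IA; have := h (rep t); rewrite fsubst_comp.
- rewrite Th_all2 /inst2.
  have E Y : scons Y f = fun X => match up2 f X with 0 => Y | S X0 => X0 end.
    by apply/funext => -[].
  have E' : s = fun i => tsubst Tvar (s i) by apply/funext => i; rewrite tsubst_id.
  split=> h Y; first by rewrite fsubst_comp -E' -E; apply/IA/h.
  by have := h Y; rewrite fsubst_comp -E' -E => /IA.
Qed.

Lemma countermodel :
  (forall A, T A -> forall (r : nat -> dom term_model) q, sat r q A) /\
  exists (r : nat -> dom term_model) q, ~ sat r q A0.
Proof.
split=> [A TA r q|].
  have -> : r = fun i => [rep (r i)] by apply/funext => i; rewrite reprK.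
  (* Axioms may have free variables; an assignment amounts to a substitution of representatives,
     under which provability is closed. *)
  by apply/sat_term_model/Th_prv/prv_subst/p_ax.
exists (fun i => [Tvar i]), id => /sat_term_model; rewrite fsubst_id => h.
have: Th (Fneg A0) by exists 0; left.
by move=> /Th_mp /(_ h) /Th_bot.
Qed.

End Completeness.

Theorem completeness (T : form -> Prop) (A : form) :
  (forall M : model, (forall B, T B -> forall (r : nat -> dom M) q, sat r q B) ->
    forall (r : nat -> dom M) q, sat r q A) ->
  provable T A.
Proof.
move=> h; apply: contrapT => /countermodel [hT [r [q]]]; apply; exact: h.
Qed.

(** * Bounded formulas and their closure properties in a model of RCA_0 *)

Lemma Delta00_fsubst A : Delta00 A -> forall s f, Delta00 (fsubst s f A).
Proof.
elim=> //= {A} [t u|t u|t X||A B _ IA _ IB|t A _ IA] s f; try by constructor.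
rewrite (_ : tsubst _ (tshift t) = tshift (tsubst s t)); first by constructor; apply: IA.
by rewrite /tshift !tsubst_comp.
Qed.

(** The element [rca_set] provides a default value for set variables when an assignment has to be
    written down. *)
Record rca_model : Type := RcaModel {
  rca_base :> model;
  rca_set : sets rca_base;
  rca_sat : forall A, RCA0 A -> forall (r : nat -> dom rca_base) q, sat r q A }.

Section Definability.
Variable M : rca_model.
Local Notation N := (dom M).

(** Nested pairs allow relations to be written with the projections [g.1], [g.2.1] and so on, from
    which a tactic can find the variable index by conversion. *)
Fixpoint ctx (k : nat) : Type := if k is k.+1 then (N * ctx k)%type else unit.

Fixpoint env (k : nat) : ctx k -> (nat -> N) -> nat -> N :=
  match k with
  | 0 => fun _ r => r
  | k.+1 => fun g r => scons g.1 (env g.2 r)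
  end.

(** Two formulas are brought to common parameters by moving those of the first
    to the even positions and those of the second to the odd ones. *)
Definition mix (T : Type) (r r' : nat -> T) (i : nat) : T :=
  if odd i then r' i./2 else r i./2.

Fixpoint ren (b : bool) (k : nat) : nat -> nat :=
  if k is k.+1 then up2 (ren b k) else fun i => (b + i.*2)%N.

Lemma mixE T (b : bool) (r r' : nat -> T) i :
  mix r r' (b + i.*2) = (if b then r' else r) i.
Proof. by rewrite /mix oddD odd_double half_bit_double; case: b. Qed.

Lemma env_mix b k (g : ctx k) r r' i :
  env g (mix r r') (ren b k i) = env g (if b then r' else r) i.
Proof. by elim: k g i => [_ i|k IH g [|i]] //=; rewrite mixE. Qed.

Definition rename b k : form -> form :=
  fsubst (fun i => Tvar (ren b k i)) (fun X => b + X.*2)%N.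

Lemma sat_mix b k (g : ctx k) r r' q q' A :
  sat (env g (mix r r')) (mix q q') (rename b k A) =
  sat (env g (if b then r' else r)) (if b then q' else q) A.
Proof.
rewrite sat_fsubst; congr (sat _ _ _); apply/funext => i /=; first exact: env_mix.
exact: mixE.
Qed.

(** [P] is definable by a bounded formula with number and set parameters: the
    variables of [P] come first in the environment, followed by the parameters. *)
Definition Dl (k : nat) (P : ctx k -> Prop) : Prop :=
  exists A r q, Delta00 A /\ forall g, sat (env g r) q A <-> P g.

Definition Tl (k : nat) (f : ctx k -> N) : Prop :=
  exists t r, forall g, eval (env g r) t = f g.

Lemma Dl_pair k k' (P : ctx k -> Prop) (P' : ctx k' -> Prop) : Dl P -> Dl P' ->
  exists A A' r q, [/\ Delta00 A, Delta00 A', forall g, sat (env g r) q A <-> P g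
    & forall g, sat (env g r) q A' <-> P' g].
Proof.
move=> [A [r [q [dA hA]]]] [A' [r' [q' [dA' hA']]]].
exists (rename false k A), (rename true k' A'), (mix r r'), (mix q q').
by split=> [||g|g]; rewrite ?sat_mix //; apply: Delta00_fsubst.
Qed.

Lemma Tl_pair k (f f' : ctx k -> N) : Tl f -> Tl f' ->
  exists t t' r, (forall g, eval (env g r) t = f g) /\ (forall g, eval (env g r) t' = f' g).
Proof.
move=> [t [r ht]] [t' [r' ht']].
exists (tsubst (fun i => Tvar (ren false k i)) t), (tsubst (fun i => Tvar (ren true k i)) t').
exists (mix r r'); split=> g; rewrite eval_tsubst -?ht -?ht'; congr eval;
by apply/funext => i /=; rewrite env_mix.
Qed.

Lemma Tl_var i k (f : ctx k -> N) :
  (forall g, env g (fun=> mzero M) i = f g) -> Tl f.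
Proof. by move=> h; exists (Tvar i), (fun=> mzero M). Qed.

Lemma Tl_const k c : Tl (fun _ : ctx k => c).
Proof.
exists (Tvar k), (fun=> c) => g /=.
by elim: k g => //= k IH g; apply: IH.
Qed.

Lemma Tl_add k (f f' : ctx k -> N) : Tl f -> Tl f' -> Tl (fun g => madd (f g) (f' g)).
Proof.
move=> h h'; have [t [t' [r [ht ht']]]] := Tl_pair h h'.
by exists (Tadd t t'), r => g /=; rewrite ht ht'.
Qed.

Lemma Tl_mul k (f f' : ctx k -> N) : Tl f -> Tl f' -> Tl (fun g => mmul (f g) (f' g)).
Proof.
move=> h h'; have [t [t' [r [ht ht']]]] := Tl_pair h h'.
by exists (Tmul t t'), r => g /=; rewrite ht ht'.
Qed.

Lemma Dl_ext k (P Q : ctx k -> Prop) : (forall g, P g <-> Q g) -> Dl P -> Dl Q.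
Proof.
by move=> PQ [A [r [q [dA hA]]]]; exists A, r, q; split=> // g; rewrite hA.
Qed.

Lemma Dl_eq k (f f' : ctx k -> N) : Tl f -> Tl f' -> Dl (fun g => f g = f' g).
Proof.
move=> h h'; have [t [t' [r [ht ht']]]] := Tl_pair h h'.
by exists (Feq t t'), r, (fun=> rca_set M); split=> [|g /=]; [constructor|rewrite ht ht'].
Qed.

Lemma Dl_lt k (f f' : ctx k -> N) : Tl f -> Tl f' -> Dl (fun g => mlt (f g) (f' g)).
Proof.
move=> h h'; have [t [t' [r [ht ht']]]] := Tl_pair h h'.
by exists (Flt t t'), r, (fun=> rca_set M); split=> [|g /=]; [constructor|rewrite ht ht'].
Qed.

Lemma Dl_mem k (f : ctx k -> N) X : Tl f -> Dl (fun g => mmem (f g) X).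
Proof.
move=> [t [r ht]].
by exists (Fmem t 0), r, (fun=> X); split=> [|g /=]; [constructor|rewrite ht].
Qed.

Lemma Dl_false k : Dl (fun _ : ctx k => False).
Proof. by exists Fbot, (fun=> mzero M), (fun=> rca_set M); split=> //; constructor. Qed.

Lemma Dl_imp k (P Q : ctx k -> Prop) : Dl P -> Dl Q -> Dl (fun g => P g -> Q g).
Proof.
move=> h h'; have [A [B [r [q [dA dB hA hB]]]]] := Dl_pair h h'.
by exists (Fimp A B), r, q; split=> [|g /=]; [constructor|rewrite hA hB].
Qed.

Lemma Dl_not k (P : ctx k -> Prop) : Dl P -> Dl (fun g => ~ P g).
Proof. by move=> h; apply: Dl_imp h (Dl_false k). Qed.

Lemma Dl_and k (P Q : ctx k -> Prop) : Dl P -> Dl Q -> Dl (fun g => P g /\ Q g).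
Proof.
move=> h h'; apply: Dl_ext (Dl_not (Dl_imp h (Dl_not h'))) => g.
by split=> [/not_implyP[? /contrapT]|[? ?]]; [|apply].
Qed.

Lemma Dl_or k (P Q : ctx k -> Prop) : Dl P -> Dl Q -> Dl (fun g => P g \/ Q g).
Proof.
move=> h h'; apply: Dl_ext (Dl_imp (Dl_not h) h') => g.
split=> [pq|[]//]; by have [?|/pq ?] := pselect (P g); [left|right].
Qed.

Lemma Dl_iff k (P Q : ctx k -> Prop) : Dl P -> Dl Q -> Dl (fun g => P g <-> Q g).
Proof. by move=> h h'; apply: Dl_and; apply: Dl_imp. Qed.

Lemma Dl_all k (f : ctx k -> N) (P : N -> ctx k -> Prop) :
  Tl f -> @Dl k.+1 (fun g => P g.1 g.2) ->
  Dl (fun g => forall x, mlt x (f g) -> P x g).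
Proof.
move=> hf hP.
have [A [B [r [q [dA dB hA hB]]]]] := Dl_pair (Dl_eq hf (Tl_const k (mzero M))) hP.
move: hf => [t [r' ht]]; exists (Fall (Fimp (Flt (Tvar 0)
  (tshift (tsubst (fun i => Tvar (ren true k i)) t))) (rename false k.+1 B))).
exists (mix r r'), (mix q q); split.
  by constructor; apply: Delta00_fsubst.
move=> g /=; have E x : eval (scons x (env g (mix r r')))
    (tshift (tsubst (fun i => Tvar (ren true k i)) t)) = f g.
  rewrite eval_tshift eval_tsubst -ht; congr eval; apply/funext => i /=.
  by rewrite env_mix.
have E' x : sat (scons x (env g (mix r r'))) (mix q q) (rename false k.+1 B) <-> P x g.
  by rewrite -(hB (x, g)) -[scons x _]/(@env k.+1 (x, g) (mix r r')) sat_mix.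
split=> h x.
  by move: (h x); rewrite E E'.
by rewrite E E'; apply: h.
Qed.

Lemma Dl_ex k (f : ctx k -> N) (P : N -> ctx k -> Prop) :
  Tl f -> @Dl k.+1 (fun g => P g.1 g.2) ->
  Dl (fun g => exists x, mlt x (f g) /\ P x g).
Proof.
move=> hf hP; apply: Dl_ext (Dl_not (@Dl_all _ f (fun x g => ~ P x g) hf (Dl_not hP))) => g.
split=> [/existsNP[x /not_implyP[? /contrapT ?]]|[x [? ?]] h]; first by exists x.
exact: (h x).
Qed.

Fixpoint Tls (k n : nat) : (ctx k -> ctx n) -> Prop :=
  match n with
  | 0 => fun _ => True
  | n.+1 => fun f => Tl (fun g => (f g).1) /\ Tls (fun g => (f g).2)
  end.

Lemma Tls_terms k n (f : ctx k -> ctx n) r : Tls f ->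
  exists (s : nat -> term) r', forall g i, eval (env g r') (s i) = env (f g) r i.
Proof.
elim: n f => [|n IH] f /=.
  move=> _; exists (fun i => Tvar (k + i)), r => g i /=.
  by elim: k g {f} => //= k IH g; apply: IH.
move=> [[t [r1 ht]] /IH[s [r2 hs]]].
exists (scons (tsubst (fun i => Tvar (ren false k i)) t)
  (fun j => tsubst (fun i => Tvar (ren true k i)) (s j))), (mix r1 r2) => g [|j] /=.
  by rewrite eval_tsubst -ht; congr eval; apply/funext => i /=; rewrite env_mix.
by rewrite eval_tsubst -hs; congr eval; apply/funext => i /=; rewrite env_mix.
Qed.

(** Definability of a relation is proved once, for variables, and then transferred to arbitrary term
    arguments; [Dl_app1], [Dl_app2] and [Dl_app3] are the instances in use. *)
Lemma Dl_subst k n (P : ctx n -> Prop) (f : ctx k -> ctx n) :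
  Tls f -> Dl P -> Dl (fun g => P (f g)).
Proof.
move=> hf [A [r [q [dA hA]]]]; have [s [r' hs]] := Tls_terms r hf.
exists (fsubst s id A), r', q; split=> [|g]; first exact: Delta00_fsubst.
by rewrite sat_fsubst -hA; under eq_fun do rewrite hs.
Qed.

Lemma Dl_app1 (P : N -> Prop) k (f : ctx k -> N) :
  @Dl 1 (fun g => P g.1) -> Tl f -> Dl (fun g => P (f g)).
Proof. by move=> dP hf; apply: (@Dl_subst _ 1 _ (fun g => (f g, tt))) dP. Qed.

Lemma Dl_app2 (P : N -> N -> Prop) k (f f' : ctx k -> N) :
  @Dl 2 (fun g => P g.1 g.2.1) -> Tl f -> Tl f' -> Dl (fun g => P (f g) (f' g)).
Proof.
by move=> dP hf hf'; apply: (@Dl_subst _ 2 _ (fun g => (f g, (f' g, tt)))) dP.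
Qed.

Lemma Dl_app3 (P : N -> N -> N -> Prop) k (f f' f'' : ctx k -> N) :
  @Dl 3 (fun g => P g.1 g.2.1 g.2.2.1) -> Tl f -> Tl f' -> Tl f'' ->
  Dl (fun g => P (f g) (f' g) (f'' g)).
Proof.
move=> dP hf hf' hf''.
by apply: (@Dl_subst _ 3 _ (fun g => (f g, (f' g, (f'' g, tt))))) dP.
Qed.

Definition Sl (k : nat) (P : ctx k -> Prop) : Prop :=
  exists Q : N -> ctx k -> Prop, @Dl k.+1 (fun g => Q g.1 g.2) /\
    forall g, P g <-> exists x, Q x g.

Lemma Sl_ext k (P Q : ctx k -> Prop) : (forall g, P g <-> Q g) -> Sl P -> Sl Q.
Proof.
by move=> PQ [R [dR hR]]; exists R; split=> // g; split=> [/PQ/hR|/hR/PQ].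
Qed.

Lemma Dl_wk k (P : ctx k -> Prop) : Dl P -> @Dl k.+1 (fun g => P g.2).
Proof.
move=> [A [r [q [dA hA]]]]; exists (shift1 A), r, q; split; first exact: Delta00_fsubst.
by move=> g; rewrite sat_fsubst -hA.
Qed.

Lemma Sl_Dl k (P : ctx k -> Prop) : Dl P -> Sl P.
Proof.
move=> dP; exists (fun _ => P); split; first exact: Dl_wk.
by move=> g; split=> [?|[]//]; exists (mzero M).
Qed.

Lemma Sl_ex_Dl k (P : N -> ctx k -> Prop) :
  @Dl k.+1 (fun g => P g.1 g.2) -> Sl (fun g => exists x, P x g).
Proof. by move=> h; exists P. Qed.

Lemma Sl_imp k (P Q : ctx k -> Prop) : Dl P -> Sl Q -> Sl (fun g => P g -> Q g).
Proof.
move=> dP [R [dR hR]]; exists (fun x g => P g -> R x g).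
split; first by apply: Dl_imp dR; apply: Dl_wk.
move=> g; split=> [PQ|[x h] /h ?]; last by apply/hR; exists x.
have [/PQ/hR[x ?]|nP] := pselect (P g); first by exists x.
by exists (mzero M).
Qed.

Lemma Sl_and k (P Q : ctx k -> Prop) : Dl P -> Sl Q -> Sl (fun g => P g /\ Q g).
Proof.
move=> dP [R [dR hR]]; exists (fun x g => P g /\ R x g).
split; first by apply: Dl_and dR; apply: Dl_wk.
move=> g; split=> [[Pg /hR[x ?]]|[x [? ?]]]; first by exists x.
by split=> //; apply/hR; exists x.
Qed.

Lemma Sl_ind (P : N -> Prop) : @Sl 1 (fun g => P g.1) ->
  P (mzero M) -> (forall n, P n -> P (madd n (mone M))) -> forall n, P n.
Proof.
move=> [Q [[A [r [q [dA hA]]]] hQ]] P0 PS.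
have {}hA x n : sat (scons x (scons n r)) q A <-> Q x (n, tt) := hA (x, (n, tt)).
have E n : sat (scons n r) q (Fex A) <-> P n.
  rewrite (hQ (n, tt)) /=; split=> [/existsNP[x /contrapT]|[x Qx] h].
    by move/hA => ?; exists x.
  exact/(h x)/hA.
have := rca_sat (ax_Sigma01_induction _ (Sigma01_intro _ dA)) r q.
rewrite /induction_axiom -/(Fex A); cbn -[Fex]; rewrite /inst1 sat_fsubst.
have -> : (fun i => eval r match i with 0 => Tzero | S i0 => Tvar i0 end) = scons (mzero M) r.
  by apply/funext => -[].
move=> h n; apply/E/h => [|{}n]; first exact/E.
rewrite sat_fsubst => /E/PS/E; congr sat; by apply/funext => -[].
Qed.

Lemma Dl_ind (P : N -> Prop) : @Dl 1 (fun g => P g.1) ->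
  P (mzero M) -> (forall n, P n -> P (madd n (mone M))) -> forall n, P n.
Proof. move=> /Sl_Dl; exact: Sl_ind. Qed.

(** The $\Pi^0_1$ side is obtained from a $\Sigma^0_1$ definition of the complement: if [B] is the
    matrix of the latter, [Fall (Fneg B)] defines [P]. *)
Lemma Sl_comprehension (P : N -> Prop) :
  @Sl 1 (fun g => P g.1) -> @Sl 1 (fun g => ~ P g.1) ->
  exists Z, forall x, mmem x Z <-> P x.
Proof.
move=> [Q [dQ hQ]] [Q' [dQ' hQ']].
have [A [B [r [q [dA dB hA hB]]]]] := Dl_pair dQ dQ'.
have {}hA x n : sat (scons x (scons n r)) q A <-> Q x (n, tt) := hA (x, (n, tt)).
have {}hB x n : sat (scons x (scons n r)) q B <-> Q' x (n, tt) := hB (x, (n, tt)).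
have EA n : sat (scons n r) q (Fex A) <-> P n.
  rewrite (hQ (n, tt)) /=; split=> [/existsNP[x /contrapT]|[x Qx] h].
    by move/hA => ?; exists x.
  exact/(h x)/hA.
have EB n : sat (scons n r) q (Fall (Fneg B)) <-> P n.
  split=> [h|p x]; last first.
    by move/hB => ?; case: (hQ' (n, tt)) => _ []//; exists x.
  by apply: contrapT => /(hQ' (n, tt)) [x Qx]; apply/(h x)/hB.
have dnB : Delta00 (Fneg B) by constructor=> //; constructor.
have := rca_sat (ax_Delta01_comprehension _ _ (Sigma01_intro _ dA) (Pi01_intro _ dnB)) r q.
rewrite /comprehension_axiom; cbn -[Fex] => h.
apply: contrapT => nZ; apply: h => [x|].
  have {}EA := EA x; have {}EB := EB x; cbn -[Fex] in EA, EB.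
  by rewrite EA EB; apply.
move=> Z h; apply: nZ; exists Z => x.
have := h x; rewrite /shift2 sat_fsubst.
rewrite (_ : (fun i => eval (scons x r) (Tvar i)) = scons x r) // EA => {}h.
by apply: contrapT => n; apply: h => h1 h2; apply: n.
Qed.

Lemma Dl_comprehension (P : N -> Prop) :
  @Dl 1 (fun g => P g.1) -> exists Z, forall x, mmem x Z <-> P x.
Proof. by move=> h; apply: Sl_comprehension; apply: Sl_Dl => //; apply: Dl_not. Qed.

End Definability.

(** * Tactics for definability *)

Ltac var_definable i n :=
  lazymatch n with
  | S ?n => first [ apply: (Tl_var (i := i)); reflexivity | var_definable (S i) n ]
  end.

Ltac term_definable :=
  lazymatch goal with
  | |- @Tl _ _ (fun g => madd _ _) => apply: Tl_add; term_definable
  | |- @Tl _ _ (fun g => mmul _ _) => apply: Tl_mul; term_definable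
  | |- @Tl _ _ (fun g => fst _) => var_definable 0%nat 30%nat
  | |- @Tl _ _ (@fst _ _) => var_definable 0%nat 1%nat
  | |- @Tl _ _ (fun _ => ?c) => apply: Tl_const
  | |- _ => first [apply: Tl_add; term_definable | apply: Tl_mul; term_definable]
  end.

(** A hook for atoms that have their own definability lemma, to be redefined locally; by default
    such goals are left open. *)
Ltac definable_atom := idtac.

Ltac definable :=
  cbn beta;
  lazymatch goal with
  | |- @Dl _ _ (fun g => _ = _) => apply Dl_eq; term_definable
  | |- @Dl _ _ (fun g => mlt _ _) => apply Dl_lt; term_definable
  | |- @Dl _ _ (fun g => mmem _ _) => apply Dl_mem; term_definable
  | |- @Dl _ _ (fun g => False) => apply Dl_false
  | |- @Dl _ _ (fun g => _ /\ _) => apply Dl_and; definable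
  | |- @Dl _ _ (fun g => _ \/ _) => apply Dl_or; definable
  | |- @Dl _ _ (fun g => _ <-> _) => apply Dl_iff; definable
  | |- @Dl _ _ (fun g => ~ _) => apply Dl_not; definable
  | |- @Dl _ _ (fun g => forall x, mlt x _ -> _) =>
      apply Dl_all; [term_definable | definable]
  | |- @Dl _ _ (fun g => exists x, mlt x _ /\ _) =>
      apply Dl_ex; [term_definable | definable]
  | |- @Dl _ _ (fun g => _ -> _) => apply Dl_imp; definable
  | |- @Sl _ _ (fun g => exists x, _) => apply Sl_ex_Dl; definable
  | |- @Sl _ _ (fun g => _ -> exists x, _) => apply Sl_imp; definable
  | |- @Sl _ _ (fun g => _ /\ exists x, _) => apply Sl_and; definable
  | |- @Sl _ _ _ => apply Sl_Dl; definable
  | |- _ => definable_atom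
  end.

(** * The natural numbers and the rational numbers of a model *)

(** The copy of the domain that carries the algebraic structure. *)
Definition num (M : rca_model) : Type := dom M.

Section Semiring.
Variable M : rca_model.
Local Notation N := (num M).
Local Notation "0" := (mzero M).
Local Notation "1" := (mone M).
Local Notation "x + y" := (madd x y).
Local Notation "x * y" := (mmul x y).
Local Notation "x < y" := (mlt x y).
Implicit Types x y z : N.

Local Notation axiom ax x y := (rca_sat ax (scons x (fun=> y)) (fun=> rca_set M)).

Lemma nS_neq0 x : x + 1 <> 0.
Proof. exact: (axiom ax_succ_neq_0 x x). Qed.

Lemma nS_inj x y : x + 1 = y + 1 -> x = y.
Proof. exact: (axiom ax_succ_inj x y). Qed.

Lemma naddn0 x : x + 0 = x.
Proof. exact: (axiom ax_add_0 x x). Qed.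

Lemma naddnS x y : x + (y + 1) = x + y + 1.
Proof. exact: (axiom ax_add_succ x y). Qed.

Lemma nmuln0 x : x * 0 = 0.
Proof. exact: (axiom ax_mul_0 x x). Qed.

Lemma nmulnS x y : x * (y + 1) = x * y + x.
Proof. exact: (axiom ax_mul_succ x y). Qed.

Lemma nltn0 x : ~ x < 0.
Proof. exact: (axiom ax_not_lt_0 x x). Qed.

Lemma nltnS x y : x < y + 1 <-> x < y \/ x = y.
Proof.
have /= h := axiom ax_lt_succ x y.
split=> [xy|xy].
  apply: contrapT => n; apply: h => h _; apply: n.
  by have [?|/(h xy) ?] := pselect (x < y); [left|right].
apply: contrapT => n; apply: h => _ h; apply/n/h.
by case: xy.
Qed.

Lemma nadd0n x : 0 + x = x.
Proof.
elim/(@Dl_ind M): x => [||x IH]; [by definable|exact: naddn0|by rewrite naddnS IH].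
Qed.

Lemma naddSn x y : x + 1 + y = x + y + 1.
Proof.
elim/(@Dl_ind M): y => [||y IH]; [by definable|by rewrite !naddn0|by rewrite !naddnS IH].
Qed.

Lemma naddC : commutative (@madd M).
Proof.
move=> x y; elim/(@Dl_ind M): y => [||y IH]; first by definable.
  by rewrite naddn0 nadd0n.
by rewrite naddnS IH naddSn.
Qed.

Lemma naddA : associative (@madd M).
Proof.
move=> x y z; elim/(@Dl_ind M): z => [||z IH]; first by definable.
  by rewrite !naddn0.
by rewrite !naddnS IH.
Qed.

Lemma nmul0n x : 0 * x = 0.
Proof.
elim/(@Dl_ind M): x => [||x IH]; first by definable.
  exact: nmuln0.
by rewrite nmulnS IH naddn0.
Qed.

Lemma nmulSn x y : (x + 1) * y = x * y + y.
Proof.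
elim/(@Dl_ind M): y => [||y IH]; first by definable.
  by rewrite !nmuln0 naddn0.
by rewrite !nmulnS IH -!naddA; congr (_ + _); rewrite !naddA (naddC y).
Qed.

Lemma nmulC : commutative (@mmul M).
Proof.
move=> x y; elim/(@Dl_ind M): y => [||y IH]; first by definable.
  by rewrite nmuln0 nmul0n.
by rewrite nmulnS nmulSn IH.
Qed.

Lemma nmul1n x : 1 * x = x.
Proof. by rewrite -[1]nadd0n nmulSn nmul0n nadd0n. Qed.

Lemma nmulDl : left_distributive (@mmul M) (@madd M).
Proof.
move=> x y z; elim/(@Dl_ind M): z => [||z IH]; first by definable.
  by rewrite !nmuln0 naddn0.
rewrite !nmulnS IH -!naddA; congr (_ + _).
by rewrite naddA (naddC _ x) -naddA.
Qed.

Lemma nmulA : associative (@mmul M).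
Proof.
move=> x y z; elim/(@Dl_ind M): z => [||z IH]; first by definable.
  by rewrite !nmuln0.
by rewrite !nmulnS -IH nmulC nmulDl [y * z * x]nmulC (nmulC y x).
Qed.

End Semiring.

HB.instance Definition _ M := gen_eqMixin (num M).
HB.instance Definition _ M := gen_choiceMixin (num M).
HB.instance Definition _ M :=
  GRing.isNmodule.Build (num M) (@naddA M) (@naddC M) (@nadd0n M).
HB.instance Definition _ M :=
  GRing.Nmodule_isComPzSemiRing.Build (num M) (@nmulA M) (@nmulC M)
    (@nmul1n M) (@nmulDl M) (@nmul0n M).

Local Open Scope ring_scope.

Lemma num_Sind M (P : num M -> Prop) : @Sl M 1 (fun g => P g.1) ->
  P 0 -> (forall n, P n -> P (n + 1)) -> forall n, P n.
Proof. exact: Sl_ind. Qed.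

Lemma num_ind M (P : num M -> Prop) : @Dl M 1 (fun g => P g.1) ->
  P 0 -> (forall n, P n -> P (n + 1)) -> forall n, P n.
Proof. exact: Dl_ind. Qed.

(** * The linear order of the numbers and the field of fractions *)

Section Order.
Variable M : rca_model.
Local Notation N := (num M).
Local Notation "x '<n' y" := (@mlt M x y) (at level 70).
Implicit Types x y z : N.

(** The axioms describe the order only through zero and successor; this reduces it to addition. The
    witness is unbounded, so the forward direction takes $\Sigma^0_1$-induction. *)
Lemma nltP x y : x <n y <-> exists z, y = x + z + 1.
Proof.
split=> [|[z ->]].
- elim/(@num_Sind M): y => [||y IH /nltnS[/IH[z ->]|->]]; first by definable.
  + by move/nltn0.
  + by exists (z + 1); rewrite addrA.
  + by exists 0; rewrite addr0.
- elim/(@num_ind M): z => [||z IH]; first by definable.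
    by rewrite addr0; apply/nltnS; right.
  by rewrite addrA; apply/nltnS; left.
Qed.

Lemma naddIn z x y : x + z = y + z -> x = y.
Proof.
elim/(@num_ind M): z => [||z IH]; first by definable.
  by rewrite !addr0.
by rewrite !addrA => /nS_inj.
Qed.

Lemma nltnn x : ~ x <n x.
Proof.
move=> /nltP[z]; rewrite -addrA addrC -{1}[x]add0r => /naddIn h.
by apply: (@nS_neq0 M z).
Qed.

Lemma nlt_total x y : [\/ x <n y, x = y | y <n x].
Proof.
suff [? |[?|?]] : x <n y \/ x = y \/ y <n x by constructor.
elim/(@num_ind M): y => [||y [xy|[->|/nltP[z ->]]]]; first by definable.
- elim/(@num_ind M): x => [||x _]; first by definable.
    by right; left.
  by right; right; apply/nltP; exists x; rewrite add0r.
- by left; apply/nltnS; left.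
- by left; apply/nltnS; right.
- elim/(@num_ind M): z => [||z _]; first by definable.
    by rewrite addr0; right; left.
  by right; right; apply/nltP; exists z; ring.
Qed.

Lemma nmulIn z x y : x * (z + 1) = y * (z + 1) -> x = y.
Proof.
have main (u v : N) : u <n v -> u * (z + 1) <> v * (z + 1).
  move=> /nltP[w ->] E; apply: (@nltnn (u * (z + 1))); apply/nltP.
  by exists (w * z + w + z); rewrite {1}E; ring.
by move=> E; case: (nlt_total x y) => // /main //; rewrite E.
Qed.

Lemma nadd_eq0 x y : x + y = 0 -> x = 0.
Proof.
case: (nlt_total x 0) => [/nltn0//|//|/nltP[z ->]].
by rewrite add0r addrAC => /nS_neq0.
Qed.

(** [(a, b, c)] stands for the fraction [(a - b) / (c + 1)]. *)
Definition frac : Type := (N * N * N)%type.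
Implicit Types t u v : frac.

Definition frac_eq t u : Prop :=
  t.1.1 * (u.2 + 1) + u.1.2 * (t.2 + 1) = u.1.1 * (t.2 + 1) + t.1.2 * (u.2 + 1).

Lemma frac_eq_refl t : frac_eq t t.
Proof. by []. Qed.

Lemma frac_eq_sym t u : frac_eq t u -> frac_eq u t.
Proof. exact: esym. Qed.

Lemma frac_eq_trans t u v : frac_eq t u -> frac_eq u v -> frac_eq t v.
Proof.
case: t u v => [[a b] c] [[a' b'] c'] [[a'' b''] c'']; rewrite /frac_eq /= => h1 h2.
(* Without subtraction, the middle fraction is eliminated by multiplying by its denominator and
   adding its cross terms to both sides, to be cancelled afterwards. *)
apply: (@nmulIn c'); apply: (@naddIn (b' * (c + 1) * (c'' + 1) + a' * (c + 1) * (c'' + 1))).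
transitivity ((a * (c' + 1) + b' * (c + 1)) * (c'' + 1) + (a' * (c'' + 1) + b'' * (c' + 1)) * (c + 1)).
  by ring.
by rewrite h1 h2; ring.
Qed.

Definition ratn : Type := quot frac_eq.
Definition ratc : frac -> ratn := cls frac_eq.

Lemma ratcE t u : ratc t = ratc u <-> frac_eq t u.
Proof. exact: (cls_eq frac_eq_refl frac_eq_sym frac_eq_trans). Qed.

Lemma ratc_surj (x : ratn) : exists t, x = ratc t.
Proof. by exists (repr x); rewrite /ratc reprK. Qed.

Definition ratn_lift1 (f : frac -> frac) (x : ratn) : ratn := ratc (f (repr x)).
Definition ratn_lift2 (f : frac -> frac -> frac) (x y : ratn) : ratn :=
  ratc (f (repr x) (repr y)).

(** The last component is [(t.2 + 1) * (u.2 + 1) - 1], as denominators are stored minus one. *)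
Definition frac_add t u : frac :=
  (t.1.1 * (u.2 + 1) + u.1.1 * (t.2 + 1), t.1.2 * (u.2 + 1) + u.1.2 * (t.2 + 1),
   t.2 * u.2 + t.2 + u.2).
Definition frac_mul t u : frac :=
  (t.1.1 * u.1.1 + t.1.2 * u.1.2, t.1.1 * u.1.2 + t.1.2 * u.1.1,
   t.2 * u.2 + t.2 + u.2).
Definition frac_opp t : frac := (t.1.2, t.1.1, t.2).

Lemma repr_ratc t : frac_eq (repr (ratc t)) t.
Proof. exact: (repr_cls frac_eq_refl frac_eq_sym frac_eq_trans). Qed.

Lemma ratc_opp t : ratn_lift1 frac_opp (ratc t) = ratc (frac_opp t).
Proof.
apply/ratcE; move: (repr_ratc t); rewrite /frac_eq /= => h.
by rewrite addrC [RHS]addrC.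
Qed.

Lemma frac_addC t u : frac_eq (frac_add t u) (frac_add u t).
Proof. by rewrite /frac_eq /frac_add /=; ring. Qed.

Lemma frac_mulC t u : frac_eq (frac_mul t u) (frac_mul u t).
Proof. by rewrite /frac_eq /frac_mul /=; ring. Qed.

Lemma frac_addr t u v : frac_eq t u -> frac_eq (frac_add t v) (frac_add u v).
Proof.
case: t u v => [[a b] c] [[a' b'] c'] [[a'' b''] c'']; rewrite /frac_eq /frac_add /= => h.
transitivity ((a * (c' + 1) + b' * (c + 1)) * (c'' + 1) * (c'' + 1)
   + (a'' + b'') * (c + 1) * (c' + 1) * (c'' + 1)); first by ring.
by rewrite h; ring.
Qed.

Lemma frac_mulr t u v : frac_eq t u -> frac_eq (frac_mul t v) (frac_mul u v).
Proof.
case: t u v => [[a b] c] [[a' b'] c'] [[a'' b''] c'']; rewrite /frac_eq /frac_mul /= => h.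
transitivity ((a * (c' + 1) + b' * (c + 1)) * (c'' + 1) * a''
   + (a' * (c + 1) + b * (c' + 1)) * (c'' + 1) * b''); first by ring.
by rewrite h -{2}h; ring.
Qed.

Lemma ratc_add t u : ratn_lift2 frac_add (ratc t) (ratc u) = ratc (frac_add t u).
Proof.
apply/ratcE; apply: frac_eq_trans (frac_addr _ (repr_ratc t)) _.
apply: frac_eq_trans (frac_addC _ _) _; apply: frac_eq_trans (frac_addr _ (repr_ratc u)) _.
exact: frac_addC.
Qed.

Lemma ratc_mul t u : ratn_lift2 frac_mul (ratc t) (ratc u) = ratc (frac_mul t u).
Proof.
apply/ratcE; apply: frac_eq_trans (frac_mulr _ (repr_ratc t)) _.
apply: frac_eq_trans (frac_mulC _ _) _; apply: frac_eq_trans (frac_mulr _ (repr_ratc u)) _.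
exact: frac_mulC.
Qed.

Lemma ratn_addA : associative (ratn_lift2 frac_add).
Proof.
move=> x y z; have [t ->] := ratc_surj x; have [u ->] := ratc_surj y.
have [v ->] := ratc_surj z; rewrite !ratc_add; apply/ratcE.
by rewrite /frac_eq /frac_add /=; ring.
Qed.

Lemma ratn_addC : commutative (ratn_lift2 frac_add).
Proof. move=> x y; apply/ratcE; exact: frac_addC. Qed.

Lemma ratn_add0 : left_id (ratc (0, 0, 0)) (ratn_lift2 frac_add).
Proof.
move=> x; have [t ->] := ratc_surj x; rewrite !ratc_add; apply/ratcE.
by rewrite /frac_eq /frac_add /=; ring.
Qed.

Lemma ratn_addN : left_inverse (ratc (0, 0, 0)) (ratn_lift1 frac_opp) (ratn_lift2 frac_add).
Proof.
move=> x; have [t ->] := ratc_surj x; rewrite ratc_opp ratc_add; apply/ratcE.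
by rewrite /frac_eq /frac_add /=; ring.
Qed.

Lemma ratn_mulA : associative (ratn_lift2 frac_mul).
Proof.
move=> x y z; have [t ->] := ratc_surj x; have [u ->] := ratc_surj y.
have [v ->] := ratc_surj z; rewrite !ratc_mul; apply/ratcE.
by rewrite /frac_eq /frac_mul /=; ring.
Qed.

Lemma ratn_mulC : commutative (ratn_lift2 frac_mul).
Proof. move=> x y; apply/ratcE; exact: frac_mulC. Qed.

Lemma ratn_mul1 : left_id (ratc (1, 0, 0)) (ratn_lift2 frac_mul).
Proof.
move=> x; have [t ->] := ratc_surj x; rewrite !ratc_mul; apply/ratcE.
by rewrite /frac_eq /frac_mul /=; ring.
Qed.

Lemma ratn_mulDl : left_distributive (ratn_lift2 frac_mul) (ratn_lift2 frac_add).
Proof.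
move=> x y z; have [t ->] := ratc_surj x; have [u ->] := ratc_surj y.
have [v ->] := ratc_surj z; rewrite !(ratc_mul, ratc_add); apply/ratcE.
by rewrite /frac_eq /frac_mul /frac_add /=; ring.
Qed.

Lemma ratn_1_neq0 : ratc (1, 0, 0) <> ratc (0, 0, 0).
Proof.
move=> /ratcE; rewrite /frac_eq /= => h; apply: (@nS_neq0 M 0).
have E : 0 + 1 = 0 :> N by move: h; rewrite !mul0r !addr0 mul1r.
exact: E.
Qed.

(** Trichotomy for [a] and [b] gives the sign. If they differ by [z + 1], the inverse has numerator
    [c + 1] up to sign and denominator [z + 1], stored as [z]. The second clause fixes the inverse
    of zero as zero, as the field structure demands. *)
Lemma ratn_inv_ex (x : ratn) :
  exists y : ratn, (x <> ratc (0, 0, 0) -> ratn_lift2 frac_mul y x = ratc (1, 0, 0)) /\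
            (x = ratc (0, 0, 0) -> y = x).
Proof.
have [xE|nx] := pselect (x = ratc (0, 0, 0)); first by exists x.
have [[[a b] c] E] := ratc_surj x.
case: (nlt_total a b) => [/nltP[z bE]|ab|/nltP[z aE]].
- exists (ratc (0, c + 1, z)); split=> // _; rewrite E ratc_mul; apply/ratcE.
  by rewrite /frac_eq /frac_mul /= bE; ring.
- by case: nx; rewrite E ab; apply/ratcE; rewrite /frac_eq /=; ring.
- exists (ratc (c + 1, 0, z)); split=> // _; rewrite E ratc_mul; apply/ratcE.
  by rewrite /frac_eq /frac_mul /= aE; ring.
Qed.

Definition ratn_inv (x : ratn) : ratn := projT1 (cid (ratn_inv_ex x)).

End Order.

HB.instance Definition _ M := gen_eqMixin (ratn M).
HB.instance Definition _ M := gen_choiceMixin (ratn M).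
HB.instance Definition _ M :=
  GRing.isZmodule.Build (ratn M) (@ratn_addA M) (@ratn_addC M) (@ratn_add0 M) (@ratn_addN M).

Lemma ratn_oner_neq0 M : ratc (1, 0, 0) != 0 :> ratn M.
Proof. by apply/eqP/ratn_1_neq0. Qed.

HB.instance Definition _ M :=
  GRing.Zmodule_isComNzRing.Build (ratn M) (@ratn_mulA M) (@ratn_mulC M)
    (@ratn_mul1 M) (@ratn_mulDl M) (@ratn_oner_neq0 M).

Lemma ratn_mulVf M (x : ratn M) : x != 0 -> ratn_inv x * x = 1.
Proof.
by move=> /eqP nx; rewrite /ratn_inv; case: cid => y /= [h _]; apply: h.
Qed.

Lemma ratn_inv0 M : ratn_inv (0 : ratn M) = 0.
Proof. by rewrite /ratn_inv; case: cid => y /= [_ h]; apply: h. Qed.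

HB.instance Definition _ M :=
  GRing.ComNzRing_isField.Build (ratn M) (@ratn_mulVf M) (@ratn_inv0 M).

(** * The order of the rationals *)

Section RatOrder.
Variable M : rca_model.
Local Notation N := (num M).
Local Notation Q := (ratn M).
Implicit Types x y : Q.

(** Nonnegativity, zero included: some representative has negative part [0]. *)
Definition ratn_pos x : Prop := exists a c : N, x = ratc (a, 0, c).

Definition ratn_le x y : bool := `[< ratn_pos (y - x) >].
Definition ratn_lt x y : bool := (y != x) && ratn_le x y.
Definition ratn_norm x : Q := if ratn_le 0 x then x else - x.

Lemma ratc_addE t u : ratc t + ratc u = ratc (frac_add t u) :> Q.
Proof. exact: ratc_add. Qed.

Lemma ratc_mulE t u : ratc t * ratc u = ratc (frac_mul t u) :> Q.
Proof. exact: ratc_mul. Qed.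

Lemma ratc_oppE t : - ratc t = ratc (frac_opp t) :> Q.
Proof. exact: ratc_opp. Qed.

Lemma ratn_le0P x : reflect (ratn_pos x) (ratn_le 0 x).
Proof. by rewrite /ratn_le subr0; apply: asboolP. Qed.

Lemma ratn_le0_add x y : ratn_le 0 x -> ratn_le 0 y -> ratn_le 0 (x + y).
Proof.
move=> /ratn_le0P[a [c ->]] /ratn_le0P[a' [c' ->]]; apply/ratn_le0P.
exists (a * (c' + 1) + a' * (c + 1)), (c * c' + c + c'); rewrite ratc_addE; apply/ratcE.
by rewrite /frac_eq /frac_add /=; ring.
Qed.

Lemma ratn_le0_mul x y : ratn_le 0 x -> ratn_le 0 y -> ratn_le 0 (x * y).
Proof.
move=> /ratn_le0P[a [c ->]] /ratn_le0P[a' [c' ->]]; apply/ratn_le0P.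
exists (a * a'), (c * c' + c + c'); rewrite ratc_mulE; apply/ratcE.
by rewrite /frac_eq /frac_mul /=; ring.
Qed.

Lemma ratn_le0_anti x : ratn_le 0 x -> ratn_le x 0 -> x = 0.
Proof.
rewrite /ratn_le sub0r => /ratn_le0P[a [c ->]] /asboolP [a' [c']].
rewrite ratc_oppE => /ratcE; rewrite /frac_eq /frac_opp /= !mul0r add0r => h.
suff -> : a = 0 by apply/ratcE; rewrite /frac_eq /=; ring.
apply: (@nmulIn M c'); rewrite mul0r; apply: (@nadd_eq0 M _ (a' * (c + 1))).
by rewrite addrC -h.
Qed.

Lemma ratn_sub_ge0 x y : ratn_le 0 (y - x) = ratn_le x y.
Proof. by rewrite /ratn_le subr0. Qed.

Lemma ratn_le0_total x : ratn_le 0 x || ratn_le x 0.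
Proof.
rewrite /ratn_le sub0r subr0; have [[[a b] c] ->] := ratc_surj x; rewrite ratc_oppE.
apply/orP; case: (nlt_total a b) => [/nltP[z ->]|->|/nltP[z ->]].
- right; apply/asboolP; exists (z + 1), c; apply/ratcE.
  by rewrite /frac_eq /=; ring.
- left; apply/asboolP; exists 0, c; apply/ratcE.
  by rewrite /frac_eq /=; ring.
- left; apply/asboolP; exists (z + 1), c; apply/ratcE.
  by rewrite /frac_eq /=; ring.
Qed.

Lemma ratn_normN x : ratn_norm (- x) = ratn_norm x.
Proof.
rewrite /ratn_norm opprK; have E : ratn_le 0 (- x) = ratn_le x 0.
  by rewrite /ratn_le subr0 sub0r.
rewrite E; case: ifP => h; case: ifP => h' //; last first.
  by have := ratn_le0_total x; rewrite h h'.
by rewrite (ratn_le0_anti h' h) oppr0.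
Qed.

Lemma ratn_ge0_norm x : ratn_le 0 x -> ratn_norm x = x.
Proof. by rewrite /ratn_norm => ->. Qed.

Lemma ratn_lt_def x y : ratn_lt x y = (y != x) && ratn_le x y.
Proof. by []. Qed.

End RatOrder.

HB.instance Definition _ M :=
  Num.IntegralDomain_isLeReal.Build (ratn M) (@ratn_le0_add M) (@ratn_le0_mul M)
    (@ratn_le0_anti M) (@ratn_sub_ge0 M) (@ratn_le0_total M) (@ratn_normN M)
    (@ratn_ge0_norm M) (@ratn_lt_def M).

(** * Numbers inside the ordered field *)

Section Embedding.
Variable M : rca_model.
Local Notation N := (num M).
Local Notation Q := (ratn M).
Implicit Types m n : N.
Local Notation "x '<n' y" := (@mlt M x y) (at level 70).

(** Inequalities between numbers are moved along this embedding into a real field, where [lra] and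
    [nra] apply. *)
Definition inq n : Q := ratc (n, 0, 0).

Lemma inq_inj : injective inq.
Proof.
move=> m n /ratcE; rewrite /frac_eq /= !mul0r !addr0 !add0r !mulr1 //.
Qed.

Lemma inq0 : inq 0 = 0. Proof. by []. Qed.
Lemma inq1 : inq 1 = 1. Proof. by []. Qed.

Lemma inqD m n : inq (m + n) = inq m + inq n.
Proof. by rewrite ratc_addE; apply/ratcE; rewrite /frac_eq /=; ring. Qed.

Lemma inqM m n : inq (m * n) = inq m * inq n.
Proof. by rewrite ratc_mulE; apply/ratcE; rewrite /frac_eq /=; ring. Qed.

Definition inqE := (inqD, inqM, inq0, inq1).

Lemma inq_ge0 n : 0 <= inq n.
Proof. by apply/ratn_le0P; exists n, 0. Qed.

Lemma inq_ge1 n : n <> 0 -> 1 <= inq n.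
Proof.
case: (nlt_total n 0) => [/nltn0//|//|/nltP[z ->]] _.
by rewrite !inqE add0r lerDr inq_ge0.
Qed.

Lemma nltE m n : m <n n <-> inq m < inq n.
Proof.
split=> [/nltP[z ->]|]; first by rewrite !inqE; have := inq_ge0 z; lra.
by case: (nlt_total m n) => // [->|/nltP[z ->]]; rewrite ?inqE ?ltxx //; have := inq_ge0 z; lra.
Qed.

(** Discreteness of the numbers, which the field arithmetic cannot see. *)
Lemma inq_lt m n : inq m < inq n -> inq m + 1 <= inq n.
Proof. by move/nltE/nltP => [z ->]; rewrite !inqE; have := inq_ge0 z; lra. Qed.

Lemma ratcV a b c : ratc (a, b, c) = (inq a - inq b) / (inq c + 1).
Proof.
have h : inq c + 1 != 0 by rewrite gt_eqF //; have := inq_ge0 c; lra.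
apply: (mulIf h); rewrite mulfVK // -inq1 -inqD /inq ratc_oppE ratc_mulE ratc_addE.
by apply/ratcE; rewrite /frac_eq /=; ring.
Qed.

Lemma ratn_pos_surj (x : Q) : 0 <= x -> exists a c, x = inq a / (inq c + 1).
Proof. by move=> /ratn_le0P[a [c ->]]; exists a, c; rewrite ratcV inq0 subr0. Qed.

(** Archimedean relative to the numbers of the model, not to the standard ones: [a / (c + 1)] is at
    most [a]. *)
Lemma archi_le (x : Q) : exists n, x <= inq n.
Proof.
have [x0|x0] := lerP x 0; first by exists 0.
have [a [c ->]] := ratn_pos_surj (ltW x0); exists a.
have hc := inq_ge0 c; have ha := inq_ge0 a.
by rewrite ler_pdivrMr ?ltr_wpDl // mulrDr mulr1 lerDr mulr_ge0.
Qed.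

Lemma archi_inv (x : Q) : 0 < x -> exists n, (inq n + 1)^-1 <= x.
Proof.
move=> x0; have [n hn] := archi_le x^-1; exists n.
have hn0 := inq_ge0 n; rewrite -[leRHS]invrK lef_pV2 ?posrE ?invr_gt0 //; lra.
Qed.

End Embedding.

(** * Coding of finite sets and course-of-values recursion *)

Section Coding.
Variable M : rca_model.
Local Notation N := (num M).
Implicit Types a b c d m n x y z : N.
Local Notation "x '<n' y" := (@mlt M x y) (at level 70).

Lemma nltSE m n : m <n n + 1 <-> inq m <= inq n.
Proof.
by rewrite nltE; split=> [/inq_lt|]; rewrite !inqE; lra.
Qed.

(** Bounded induction on [m] for the statement that no [k] below [m] satisfies [P]. *)
Lemma least (P : N -> Prop) n : @Dl M 1 (fun g => P g.1) -> P n ->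
  exists m, P m /\ forall k, k <n m -> ~ P k.
Proof.
move=> dP Pn; apply: contrapT => nex.
suff h : forall m k, k <n m -> ~ P k by apply: h Pn; apply/nltSE.
apply: (@num_ind M) => [|k /nltn0//|m IH k].
  by definable; apply: Dl_app1; [|term_definable].
move=> /nltnS[/IH //|-> Pm]; by apply: nex; exists m.
Qed.

Definition npr x y : N := (x + y) * (x + y) + x.

(** With [s = x + y] the code lies between $s^2$ and $s^2 + s$, hence below $(s+1)^2$. *)
Lemma npr_sum_le x y x' y' : inq (x + y) < inq (x' + y') -> inq (npr x y) < inq (npr x' y').
Proof.
move=> /inq_lt; rewrite /npr !inqE.
have := inq_ge0 x; have := inq_ge0 y; have := inq_ge0 x'; have := inq_ge0 y'.
nra.
Qed.

Lemma npr_inj x y x' y' : npr x y = npr x' y' -> x = x' /\ y = y'.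
Proof.
move=> E; have sE : x + y = x' + y'.
  apply: inq_inj; apply/eqP; rewrite eq_le !leNgt.
  by apply/andP; split; apply/negP => /npr_sum_le; rewrite E ltxx.
have xE : x = x'.
  by move: E; rewrite /npr sE addrC [RHS]addrC => /naddIn.
by split=> //; move: sE; rewrite xE addrC [RHS]addrC => /naddIn.
Qed.

Lemma npr_le1 x y : inq x <= inq (npr x y).
Proof. rewrite /npr !inqE; have := inq_ge0 x; have := inq_ge0 y; nra. Qed.

Lemma npr_le2 x y : inq y <= inq (npr x y).
Proof.
rewrite /npr !inqE; have hx := inq_ge0 x; have hy := inq_ge0 y.
have [->|/inq_ge1 h] := pselect (y = 0); rewrite ?inqE; nra.
Qed.

(** The bound on the quotient keeps divisibility a bounded formula; by [dvdP] it is harmless for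
    nonzero [d]. *)
Definition dvd d c : Prop := exists e, e <n c + 1 /\ c = d * e.

Lemma dvdP d c : d <> 0 -> (dvd d c <-> exists e, c = d * e).
Proof.
move=> /inq_ge1 d1; split=> [[e [_ ->]]|[e ->]]; exists e => //; split=> //.
by apply/nltSE; rewrite inqE; have := inq_ge0 e; nra.
Qed.

Lemma dvd_sub d u v : d <> 0 -> dvd d u -> dvd d (u + v) -> dvd d v.
Proof.
move=> d0 /(dvdP _ d0)[e ->] /(dvdP _ d0)[f E]; apply/dvdP => //.
case: (nlt_total e f) => [/nltP[z fE]|fE|/nltP[z fE]].
- by exists (z + 1); apply: (@naddIn M (d * e)); rewrite addrC E fE; ring.
- by exists 0; apply: (@naddIn M (d * e)); rewrite addrC E fE; ring.
- exfalso; move: (congr1 (@inq M) E); rewrite fE !inqE.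
  have := inq_ge0 z; have := inq_ge0 v; have := inq_ge1 d0; have := inq_ge0 f; nra.
Qed.

Lemma dvd_mull d u v : d <> 0 -> dvd d u -> dvd d (v * u).
Proof.
by move=> d0 /(dvdP _ d0)[e ->]; apply/dvdP => //; exists (v * e); ring.
Qed.

(** Pairwise coprime moduli: a set of numbers [y < n] is coded by the product
    of the corresponding moduli, if [b] is divisible by all positive [i <= n]. *)
Definition modulus b y : N := (y + 1) * b + 1.
Definition el b c y : Prop := dvd (modulus b y) c.
Definition divisible_upto n b : Prop :=
  b <> 0 /\ forall i : N, i <n n -> dvd (i + 1) b.

Lemma Dl_dvd k (f f' : ctx M k -> N) : Tl f -> Tl f' -> Dl (fun g => dvd (f g) (f' g)).
Proof.
have h : @Dl M 2 (fun g => dvd g.1 g.2.1) by rewrite /dvd; definable.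
exact: (Dl_app2 h).
Qed.

Lemma Dl_el k (f f' f'' : ctx M k -> N) : Tl f -> Tl f' -> Tl f'' ->
  Dl (fun g => el (f g) (f' g) (f'' g)).
Proof. by move=> h h' h''; apply: Dl_dvd => //; rewrite /modulus; apply: Tl_add (Tl_const _ _); apply: Tl_mul => //; apply: Tl_add (Tl_const _ _). Qed.

Local Ltac definable_atom ::=
  lazymatch goal with
  | |- @Dl _ _ (fun g => dvd _ _) => apply: Dl_dvd; term_definable
  | |- @Dl _ _ (fun g => el _ _ _) => apply: Dl_el; term_definable
  | |- _ => idtac
  end.

Lemma num_neq0 x : x + 1 <> 0 :> N.
Proof. exact: nS_neq0. Qed.

(** A substitute for the factorial of [n], which is not given by a term. *)
Lemma divisible_ex n : exists b, divisible_upto n b.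
Proof.
elim/(@num_Sind M): n => [||n [b [b0 hb]]].
- by rewrite /divisible_upto; definable.
- by exists 1; split=> [E|i /nltn0//]; apply: (@num_neq0 0); rewrite add0r.
- exists ((n + 1) * b); split=> [|i /nltnS[/hb h|->]].
  + move=> /(congr1 (@inq M)); rewrite !inqE; have := inq_ge1 b0; have := inq_ge0 n; nra.
  + exact: dvd_mull (@num_neq0 _) h.
  + by apply/dvdP; [exact: num_neq0|exists b].
Qed.

(** The modulus is coprime to [b], because [c * modulus b x = (x + 1) * (c * b) + c]. *)
Lemma dvd_modulus b c x : dvd (modulus b x) (c * b) -> dvd (modulus b x) c.
Proof.
have d0 : modulus b x <> 0 by apply: num_neq0.
move=> h; apply: (@dvd_sub _ ((x + 1) * (c * b))) => //; first exact: dvd_mull.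
apply/dvdP => //; exists c; rewrite /modulus; ring.
Qed.

(** Multiplying by a modulus adds exactly one element. Two distinct moduli differ by [(z + 1) * b]
    with [z < n]; as [z + 1] divides [b], a modulus that divides [c * ((z + 1) * b)] divides
    [c * b * b], and then [c] by coprimality. *)
Lemma el_mul n b c x y : divisible_upto n b -> x <n n -> y <n n ->
  el b (c * modulus b y) x <-> el b c x \/ x = y.
Proof.
move=> [b0 hb] xn yn; have d0 : modulus b x <> 0 by apply: num_neq0.
split=> [h|[h|->]]; last 2 first.
- by rewrite /el mulrC; apply: dvd_mull.
- by rewrite /el; apply: dvd_mull; [apply: num_neq0|apply/dvdP; [apply: num_neq0|exists 1; rewrite mulr1]].
have main (z : N) : z <n n -> dvd (modulus b x) (c * ((z + 1) * b)) -> el b c x.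
  move=> zn h1; have /(dvdP _ (@num_neq0 z))[t bE] := hb _ zn.
  apply/dvd_modulus/dvd_modulus.
  have -> : c * b * b = t * (c * ((z + 1) * b)) by rewrite {2}bE; ring.
  exact: dvd_mull.
case: (nlt_total x y) => [/nltP[z yE]|->|/nltP[z xE]]; [left|by right|left].
- apply: (main z).
    by apply/nltE; move/nltE: yn; rewrite yE !inqE; have := inq_ge0 x; lra.
  apply: (@dvd_sub _ (c * modulus b x)) => //.
    by apply: dvd_mull => //; apply/dvdP => //; exists 1; rewrite mulr1.
  by move: h; rewrite /el (_ : c * modulus b y = c * modulus b x + c * ((z + 1) * b)) // yE /modulus; ring.
- apply: (main z).
    by apply/nltE; move/nltE: xn; rewrite xE !inqE; have := inq_ge0 y; lra.
  apply: (@dvd_sub _ (c * modulus b y)) => //.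
  rewrite (_ : _ + _ = c * modulus b x); last by rewrite xE /modulus; ring.
  by apply: dvd_mull => //; apply/dvdP => //; exists 1; rewrite mulr1.
Qed.

Lemma el1 b x : b <> 0 -> ~ el b 1 x.
Proof.
move=> /inq_ge1 b1 /dvdP [|e]; first exact: num_neq0.
move=> /(congr1 (@inq M)); rewrite /modulus !inqE.
have [->|/inq_ge1 he] := pselect (e = 0); rewrite ?inqE; first lra.
have h : 0 <= inq x * inq b * inq e by rewrite !mulr_ge0 ?inq_ge0.
nra.
Qed.

Section Recursion.
(** [F Z x] decides whether [x] belongs to the set under construction, from its
    members [Z] below [x]; definability is only required for the finite sets
    that have a code. *)
Variable F : (N -> Prop) -> N -> Prop.
Hypothesis F_local : forall Z Z' x,
  (forall y : N, y <n x -> (Z y <-> Z' y)) -> F Z x <-> F Z' x.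
Hypothesis F_Dl : @Dl M 3 (fun g => F (el g.1 g.2.1) g.2.2.1).

Definition computes b c n : Prop := forall y : N, y <n n -> (el b c y <-> F (el b c) y).

(** The parameter [b] is fixed for the final bound [n] while [c] gains at most one factor per step.
    That [c] has no elements from [m] up to [n] is carried along, so that the decision on [m] is the
    only change. *)
Lemma computes_ex n : exists b c, computes b c n.
Proof.
have [b hb] := divisible_ex n; exists b.
suff: forall m : N, m <n n + 1 -> exists c : N, (forall y : N, y <n m -> (el b c y <-> F (el b c) y))
    /\ (forall y : N, y <n n -> ~ y <n m -> ~ el b c y).
  by case/(_ n) => [|c [hc _]]; [apply/nltSE|exists c].
apply: (@num_Sind M) => [|_|m IH mn].
- by definable; apply: (Dl_app3 (P := fun b c x => F (el b c) x)) F_Dl _ _ _; term_definable.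
- by exists 1; split=> [y /nltn0//|y _ _]; apply/el1; case: hb.
have {}mn : m <n n by apply/nltE; move/nltE: mn; rewrite !inqE; lra.
case: IH => [|c [h1 h2]]; first by apply/nltnS; left.
have step c' : (forall y : N, y <n n -> (el b c' y <-> el b c y \/ (y = m /\ F (el b c) m))) ->
    exists c, (forall y : N, y <n m + 1 -> (el b c y <-> F (el b c) y))
    /\ (forall y : N, y <n n -> ~ y <n m + 1 -> ~ el b c y).
  have mm (y : N) : y <n m -> y <n n by move=> /nltE ym; apply/nltE; move/nltE: mn; lra.
  move=> hc'; exists c'; have old (y : N) : y <n m -> (el b c' y <-> el b c y).
    move=> ym; rewrite (hc' _ (mm _ ym)); split=> [[//|h]|]; last by left.
    by move: ym; rewrite (proj1 h) => /nltnn.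
  have Fold y : inq y <= inq m -> (F (el b c') y <-> F (el b c) y).
    move=> ym; apply: F_local => z zy; apply/old/nltE; move/nltE: zy; lra.
  split=> [y /nltnS[ym|->]|y yn ny].
  + by rewrite old // Fold ?h1 //; move/nltE/ltW: ym.
  + rewrite hc' // Fold //; split=> [[h|[]//]|]; last by right.
    by case: (h2 m) => //; apply: nltnn.
  + rewrite hc' // => -[|h]; first by apply: h2 => // ym; apply: ny; apply/nltnS; left.
    by apply: ny; apply/nltnS; right; case: h.
have [Fm|nFm] := pselect (F (el b c) m).
  apply: (step (c * modulus b m)) => y yn; rewrite (el_mul c hb) //.
  by split=> [[h|h]|[h|[h _]]]; [left|right|left|right].
apply: (step c) => y yn; split=> [h|[//|h]]; first by left.
by case: nFm; case: h.
Qed.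

(** At the least disagreement both codes have the same smaller elements, so [F_local] forces
    agreement there too. *)
Lemma computes_unique b c b' c' n : computes b c n -> computes b' c' n ->
  forall y : N, y <n n -> (el b c y <-> el b' c' y).
Proof.
move=> h h' y yn; apply: contrapT => ne.
have [||m [[mn nm] min]] := @least (fun m => m <n n /\ ~ (el b c m <-> el b' c' m)) y.
- by definable.
- by [].
apply: nm; rewrite h // h' //; apply: F_local => z zm; apply: contrapT => nz.
apply: (min _ zm); split=> //; apply/nltE; move/nltE: mn; move/nltE: zm; lra.
Qed.

(** By existence and uniqueness of computations, membership of [x] means that some computation up to
    [x] contains [x], and non-membership that some computation omits it. Both are $\Sigma^0_1$, so
    comprehension applies. *)
Theorem course_of_values : exists D, forall x : N, mmem x D <-> F (fun y => mmem y D) x.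
Proof.
have W b c b' c' n : computes b c (n + 1) -> computes b' c' (n + 1) -> (el b c n <-> el b' c' n).
  by move=> h h'; apply: computes_unique h h' _ _; apply/nltSE.
have down b c m n : computes b c n -> inq m <= inq n -> computes b c m.
  by move=> h mn y ym; apply: h; apply/nltE; move/nltE: ym; lra.
(* The number [w] bounds both [b] and [c], which leaves a single unbounded quantifier. *)
have [||D hD] := @Sl_comprehension M (fun x : N => exists w : N, exists b : N, b <n w + 1 /\
    exists c : N, c <n w + 1 /\ (forall y : N, y <n x + 1 -> (el b c y <-> F (el b c) y)) /\ el b c x).
- by definable; apply: (Dl_app3 (P := fun b c x => F (el b c) x)) F_Dl _ _ _; term_definable.
- have : @Sl M 1 (fun g => (fun x : N => exists w : N, exists b : N, b <n w + 1 /\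
    exists c : N, c <n w + 1 /\ (forall y : N, y <n x + 1 -> (el b c y <-> F (el b c) y)) /\
      ~ el b c x) g.1).
    by definable; apply: (Dl_app3 (P := fun b c x => F (el b c) x)) F_Dl _ _ _; term_definable.
  apply: Sl_ext => -[x []] /=; split.
    move=> [w [b [_ [c [_ [h n]]]]]] [w' [b' [_ [c' [_ [h' n']]]]]].
    by apply/n/(W _ _ _ _ _ h h').
  move=> nex; have [b [c h]] := computes_ex ((x : N) + 1).
  exists (b + c), b; split; first by apply/nltSE; rewrite inqE; have := inq_ge0 c; lra.
  exists c; split; first by apply/nltSE; rewrite inqE; have := inq_ge0 b; lra.
  split=> // xE; apply: nex; exists (b + c), b.
  split; first by apply/nltSE; rewrite inqE; have := inq_ge0 c; lra.
  by exists c; split; first by apply/nltSE; rewrite inqE; have := inq_ge0 b; lra.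
have {}hD b c x : computes b c (x + 1) -> (mmem x D <-> el b c x).
  move=> h; rewrite hD; split=> [[w [b' [_ [c' [_ [h' n']]]]]]|xE].
    by apply/(W _ _ _ _ _ h h').
  exists (b + c), b; split; first by apply/nltSE; rewrite inqE; have := inq_ge0 c; lra.
  by exists c; split; first by apply/nltSE; rewrite inqE; have := inq_ge0 b; lra.
exists D => x; have [b [c h]] := computes_ex (x + 1).
rewrite (hD b c) // h; last by apply/nltSE.
apply: F_local => y yx; rewrite (hD b c) //; apply: down h _.
by move/nltE: yx => yx; rewrite !inqE; lra.
Qed.

End Recursion.
End Coding.

(** * The meaning of the sentence in a model *)

(** Each [s...] below interprets the notion of [Defs] with the same name, and
    spells out the connectives so that satisfaction of the sentence is
    convertible to [caristi_statement]. *)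
Section Interpretation.
Variable M : model.
Local Notation N := (dom M).
Local Notation "0" := (mzero M).
Local Notation "1" := (mone M).
Local Notation "x + y" := (madd x y).
Local Notation "x * y" := (mmul x y).
Local Notation "x < y" := (mlt x y).

Definition sneg (A : Prop) : Prop := A -> False.
Definition sor (A B : Prop) : Prop := sneg A -> B.
Definition sand (A B : Prop) : Prop := sneg (A -> sneg B).
Definition sex (T : Type) (P : T -> Prop) : Prop := sneg (forall x, sneg (P x)).

Definition sle (x y : N) : Prop := sor (x < y) (x = y).

Definition spair (x y : N) : N := (x + y) * (x + y) + x.

Record srat : Type := SRat { spos : N; sneg_part : N; sden : N }.

Definition scode (q : srat) : N := spair (spair (spos q) (sneg_part q)) (sden q).

Definition scanonical (q : srat) : Prop :=
  sand (0 < sden q) (sand (sor (spos q = 0) (sneg_part q = 0))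
    (forall u v w : N, sand (spos q + sneg_part q = u * w) (sden q = v * w) -> w = 1)).

Definition sallQ (P : srat -> Prop) : Prop :=
  forall a b c : N, scanonical (SRat a b c) -> P (SRat a b c).
Definition sexQ (P : srat -> Prop) : Prop :=
  sex (fun a => sex (fun b => sex (fun c =>
    sand (scanonical (SRat a b c)) (P (SRat a b c))))).

Definition sq0 : srat := SRat 0 0 1.
Definition sqinv (n : N) : srat := SRat 1 0 n.
Definition sqopp (q : srat) : srat := SRat (sneg_part q) (spos q) (sden q).
Definition sqadd (q r : srat) : srat :=
  SRat (spos q * sden r + spos r * sden q)
       (sneg_part q * sden r + sneg_part r * sden q)
       (sden q * sden r).
Definition sqeq (q r : srat) : Prop :=
  spos q * sden r + sneg_part r * sden q = spos r * sden q + sneg_part q * sden r.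
Definition sqlt (q r : srat) : Prop :=
  spos q * sden r + sneg_part r * sden q < spos r * sden q + sneg_part q * sden r.
Definition sqle (q r : srat) : Prop :=
  sle (spos q * sden r + sneg_part r * sden q) (spos r * sden q + sneg_part q * sden r).

Definition sqabs (q : srat) (P : srat -> Prop) : Prop :=
  sand (sqle sq0 q -> P q) (sqlt q sq0 -> P (sqopp q)).

Definition sexuniqueQ (P : srat -> Prop) : Prop :=
  sexQ (fun q => sand (P q) (sallQ (fun r => P r -> sqeq r q))).

Definition srexp : Type := N -> srat -> Prop.

Definition srset (X : sets M) : srexp := fun n q => mmem (spair n (scode q)) X.
Definition srconst (q : srat) : srexp := fun _ r => sqeq r q.
Definition sradd (x y : srexp) : srexp :=
  fun n r => sexQ (fun a => sexQ (fun b => sand (x n a) (sand (y n b) (sqeq r (sqadd a b))))).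
Definition sropp (x : srexp) : srexp := fun n r => sexQ (fun a => sand (x n a) (sqeq r (sqopp a))).
Definition srabs (x : srexp) : srexp :=
  fun n r => sexQ (fun a => sand (x n a) (sqabs a (fun s => sqeq r s))).

Definition srle (x y : srexp) : Prop :=
  sallQ (fun eps => sqlt sq0 eps ->
    sex (fun N => forall n, sle N n -> sexQ (fun a => sexQ (fun b =>
      sand (x n a) (sand (y n b) (sqle a (sqadd b eps))))))).
Definition sreq (x y : srexp) : Prop := sand (srle x y) (srle y x).
Definition srlt (x y : srexp) : Prop := sand (srle x y) (sneg (sreq x y)).

Definition sis_seq (X : sets M) : Prop :=
  sand (forall k, mmem k X -> sex (fun n => sexQ (fun q => k = spair n (scode q))))
    (forall n, sexuniqueQ (fun q => mmem (spair n (scode q)) X)).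

Definition sis_real (X : sets M) : Prop :=
  sand (sis_seq X)
   (sallQ (fun eps => sqlt sq0 eps ->
    sex (fun N => forall m n, sle N m -> sle N n ->
      sexQ (fun a => sexQ (fun b => sand (srset X m a) (sand (srset X n b)
        (sqabs (sqadd a (sqopp b)) (fun s => sqlt s eps)))))))).

Definition sball (delta : srat) (y : srexp) (p : srat) : Prop :=
  srlt (srabs (sradd y (sropp (srconst p)))) (srconst delta).

Definition sfval (F : sets M) (q : srat) (i : N) (r : srat) : Prop :=
  mmem (spair (spair (scode q) i) (scode r)) F.

Definition sis_pfun (F : sets M) : Prop :=
  sand (forall k, mmem k F -> sexQ (fun q => sex (fun i => sexQ (fun r =>
          k = spair (spair (scode q) i) (scode r)))))
    (sallQ (fun q => forall i, sexuniqueQ (fun r => sfval F q i r))).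

Definition sin_dom (F : sets M) (x : srexp) : Prop :=
  sallQ (fun eps => sqlt sq0 eps ->
    sex (fun N => sand (0 < N)
      (sallQ (fun q => sallQ (fun r => sball (sqinv N) x q -> sball (sqinv N) x r ->
        forall i j, sle N i -> sle N j ->
          sexQ (fun a => sexQ (fun b => sand (sfval F q i a) (sand (sfval F r j b)
            (sqabs (sqadd a (sqopp b)) (fun s => sqlt s eps)))))))))).

Definition sfapp (F : sets M) (x : srexp) : srexp :=
  fun i r => sexQ (fun q => sand (x i q) (sfval F q i r)).

Definition scontinuous (F : sets M) : Prop :=
  sand (sis_pfun F) (forall X, sis_real X -> sin_dom F (srset X)).

Definition spow2 (n v : N) : Prop :=
  sex (fun E : sets M =>
    sand (forall k, mmem k E -> sex (fun m => sex (fun w => k = spair m w)))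
    (sand (forall m, sex (fun w => sand (mmem (spair m w) E)
             (forall w', mmem (spair m w') E -> w' = w)))
    (sand (mmem (spair 0 1) E)
    (sand (forall m w, mmem (spair m w) E -> mmem (spair (m + 1) (w * (1 + 1))) E)
    (mmem (spair n v) E))))).

Definition sball2 (n : N) (x : srexp) (p : srat) : Prop :=
  sex (fun v => sand (spow2 n v) (sball (sqinv v) x p)).

Definition sgval (G : sets M) (i : N) (q r : srat) : Prop :=
  mmem (spair (spair i (scode q)) (scode r)) G.

Definition sis_lsc (G : sets M) : Prop :=
  sand (forall k, mmem k G -> sex (fun i => sexQ (fun q => sexQ (fun r =>
          k = spair (spair i (scode q)) (scode r)))))
  (sand (forall i, sallQ (fun q => sexuniqueQ (fun r => sgval G i q r)))
    (forall i, sallQ (fun q => sallQ (fun r => sgval G i q r -> sqle sq0 r)))).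

Definition sfinite_valued (G : sets M) : Prop :=
  forall X, sis_real X -> sexQ (fun b => forall n, sex (fun i => sexQ (fun p =>
    sand (sball2 n (srset X) p) (sexQ (fun r => sand (sgval G i p r) (sqle r b)))))).

Definition sgmin (G : sets M) (k : N) (q : srat) : srexp :=
  fun _ r =>
    sand (sex (fun i => sand (sle i k) (sgval G i q r)))
    (forall i, sle i k -> sallQ (fun s => sgval G i q s -> sqle r s)).

Definition slsc_le (G : sets M) (x y z : srexp) : Prop :=
  sallQ (fun eps => sqlt sq0 eps -> forall m, sex (fun n => forall j,
    sallQ (fun q => sball2 n y q ->
      sex (fun i => sexQ (fun p => sand (sball2 m x p)
        (srle (sgmin G i p) (sradd (sradd (sgmin G j q) z) (srconst eps)))))))).

Definition caristi_statement : Prop :=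
  forall F G,
    scontinuous F ->
    sand (sis_lsc G) (sfinite_valued G) ->
    (forall X, sis_real X ->
       slsc_le G (sfapp F (srset X)) (srset X)
         (sropp (srabs (sradd (srset X) (sropp (sfapp F (srset X))))))) ->
    sex (fun X => sand (sis_real X) (sreq (sfapp F (srset X)) (srset X))).

End Interpretation.

(** * Reading the interpreted notions in the ordered field *)

Lemma sandE A B : sand A B = (A /\ B).
Proof.
apply/propext; split=> [h|[a b]]; last by apply.
by apply: contrapT => n; apply: h => a b; apply: n.
Qed.

Lemma sorE A B : sor A B = (A \/ B).
Proof.
apply/propext; split=> [h|[a|b]//]; have [a|/h b] := pselect A; by [left|right].
Qed.

Lemma sexE T (P : T -> Prop) : sex P = exists x, P x.
Proof.
apply/propext; split=> [h|[x Px] /(_ x)]; last exact.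
by apply: contrapT => n; apply: h => x Px; apply: n; exists x.
Qed.

Section Spec.
Variable M : rca_model.
Local Notation N := (num M).
Local Notation Q := (ratn M).
Local Notation srat := (srat M).
Local Notation srexp := (srexp M).
Implicit Types m n : N.
Implicit Types q r : srat.
Implicit Types x y : srexp.

Lemma sleE m n : @sle M m n = (inq m <= inq n).
Proof. by rewrite /sle sorE; apply/propext; rewrite -nltSE; apply: iff_sym; apply: nltnS. Qed.

Lemma sallQE (P : srat -> Prop) : sallQ P = forall q, scanonical q -> P q.
Proof. by apply/propext; split=> [h [a b c]|h a b c]; apply: h. Qed.

Lemma sexQE (P : srat -> Prop) : sexQ P = exists q, scanonical q /\ P q.
Proof.
rewrite /sexQ sexE; apply/propext; split.
  move=> [a]; rewrite sexE => -[b]; rewrite sexE => -[c]; rewrite sandE => h.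
  by exists (SRat a b c).
move=> [[a b c] h]; exists a; rewrite sexE; exists b; rewrite sexE; exists c.
by rewrite sandE.
Qed.

Definition ival (n : N) : Q := inq n.
Definition val q : Q := (ival (spos q) - ival (sneg_part q)) / ival (sden q).
(** Sums of canonical triples need not be in lowest terms, but their denominators stay positive,
    which suffices for comparing values. *)
Definition pos_den q : Prop := 0 < ival (sden q).

Lemma canonical_pos_den q : scanonical q -> pos_den q.
Proof. by rewrite /scanonical sandE => -[/nltE]. Qed.
Hint Resolve canonical_pos_den : core.

Lemma val_frac (a b c d : Q) : 0 < b -> 0 < d -> (a / b <= c / d) = (a * d <= c * b).
Proof. by move=> b0 d0; rewrite ler_pdivrMr // mulrAC ler_pdivlMr. Qed.

Lemma sqleE q r : pos_den q -> pos_den r -> sqle q r = (val q <= val r).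
Proof.
move=> hq hr; rewrite /sqle sleE /val val_frac // !(inqD, inqM) -!/(ival _).
by congr is_true; apply/idP/idP; lra.
Qed.

Lemma sqltE q r : pos_den q -> pos_den r -> sqlt q r = (val q < val r).
Proof.
move=> hq hr; apply/propext; rewrite /sqlt nltE !(inqD, inqM) -!/(ival _).
by rewrite [val q < val r]ltNge /val val_frac // -ltNge; split; lra.
Qed.

Lemma sqeqE q r : pos_den q -> pos_den r -> sqeq q r = (val q = val r).
Proof.
move=> hq hr; have := sqleE hq hr; have := sqleE hr hq; rewrite /sqle !sleE => E1 E2.
apply/propext; split=> [h|h].
  by apply/eqP; rewrite eq_le; apply/andP; split; [rewrite -E2|rewrite -E1]; rewrite h lexx.
apply: inq_inj; apply/eqP; rewrite eq_le; apply/andP.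
by split; [rewrite E2|rewrite E1]; rewrite h lexx.
Qed.

Lemma pos_den_add q r : pos_den q -> pos_den r -> pos_den (sqadd q r).
Proof. by rewrite /pos_den /ival inqM; apply: mulr_gt0. Qed.

Lemma pos_den_opp q : pos_den q -> pos_den (sqopp q).
Proof. by []. Qed.

Lemma pos_den0 : pos_den (sq0 M).
Proof. exact: ltr01. Qed.
Hint Resolve pos_den_add pos_den_opp pos_den0 : core.

Lemma val_add q r : pos_den q -> pos_den r -> val (sqadd q r) = val q + val r.
Proof.
rewrite /pos_den /val /= => hq hr; rewrite /ival !(inqD, inqM) -!/(ival _).
by field; rewrite !gt_eqF.
Qed.

Lemma val_opp q : val (sqopp q) = - val q.
Proof. by rewrite /val /= -mulNr opprB. Qed.

Lemma val0 : val (sq0 M) = 0.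
Proof. by rewrite /val /= subrr mul0r. Qed.

Lemma val_inv n : val (sqinv n) = (ival n)^-1.
Proof. by rewrite /val /= /ival inq0 inq1 subr0 mul1r. Qed.

Lemma lowest_terms (a c : N) : exists e d : N,
  [/\ 0 < ival d, ival e / ival d = ival a / (ival c + 1)
    & forall u v w : N, e = u * w -> d = v * w -> w = 1].
Proof.
have [||d [[d0 [e [_ E]]] min]] := @least M (fun d : N => d <> 0 /\
    exists e : N, mlt e (a * d + 1) /\ e * (c + 1) = a * d) (c + 1).
- by definable.
- by split; [exact: nS_neq0|exists a; split=> //; apply/nltSE; rewrite !inqE;
    have := inq_ge0 a; have := inq_ge0 c; nra].
have hc := inq_ge0 c; have d1 := inq_ge1 d0; exists e, d; split.
- by rewrite /ival; lra.
- apply/eqP; rewrite eqr_div; [|by rewrite /ival gt_eqF//; lra|by rewrite /ival gt_eqF//; lra].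
  by rewrite /ival -inq1 -inqD -!inqM E.
move=> u v w eE dE.
have w0 : w <> 0 by move=> w0; apply: d0; rewrite dE w0 mulr0.
have v0 : v <> 0 by move=> v0; apply: d0; rewrite dE v0 mul0r.
have w1 := inq_ge1 w0; have v1 := inq_ge1 v0.
have uE : u * (c + 1) = a * v.
  case: (nlt_total w 0) => [/nltn0//|//|/nltP[z wE]].
  apply: (@nmulIn M z); rewrite add0r in wE; rewrite -wE mulrAC -eE E dE; ring.
case: (nlt_total w 1) => [/nltE|//|/nltE].
  by rewrite inqE ltNge w1.
rewrite inqE => w2; case: (min v).
  by apply/nltE; rewrite dE inqE; nra.
split=> //; exists u; split=> //; apply/nltSE; rewrite -uE !inqE.
have := inq_ge0 u; nra.
Qed.

Lemma canonical_ex (z : Q) : exists q, scanonical q /\ val q = z.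
Proof.
have main (z' : Q) : 0 <= z' -> exists e d : N, [/\ 0 < ival d, ival e / ival d = z'
    & forall u v w : N, e = u * w -> d = v * w -> w = 1].
  by move=> /ratn_pos_surj[a [c ->]]; apply: lowest_terms.
have [/main[e [d [d0 E h]]]|] := lerP 0 z.
  exists (@SRat M e (0 : N) d); split; last by rewrite /val /= /ival inq0 subr0.
  rewrite /scanonical !sandE sorE; split; [exact/nltE|split; [by right|]] => u v w.
  by rewrite sandE => -[e1 e2]; apply: (h u v w) e2; apply: etrans e1; apply: esym; exact: naddn0.
rewrite -oppr_gt0 => /ltW/main[e [d [d0 E h]]].
exists (@SRat M (0 : N) e d); split; last first.
  by rewrite /val /= /ival inq0 sub0r mulNr E opprK.
rewrite /scanonical !sandE sorE; split; [exact/nltE|split; [by left|]] => u v w.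
by rewrite sandE => -[e1 e2]; apply: (h u v w) e2; apply: etrans e1; apply: esym; exact: nadd0n.
Qed.

Lemma sqabsE q (P : srat -> Prop) : pos_den q ->
  sqabs q P = ((0 <= val q -> P q) /\ (val q < 0 -> P (sqopp q))).
Proof. by move=> hq; rewrite /sqabs sandE sqleE // sqltE // val0. Qed.

Lemma sqabs_eqE q r : pos_den q -> pos_den r ->
  sqabs q (fun s => sqeq r s) = (val r = `|val q|).
Proof.
move=> hq hr; rewrite sqabsE // !sqeqE // val_opp; apply/propext.
case: (lerP 0 (val q)) => h.
  by rewrite ger0_norm //; split=> [[h1 _]|E]; [exact: h1|split].
by rewrite ltr0_norm //; split=> [[_ h1]|E]; [exact: h1|split].
Qed.

Lemma sqabs_ltE q r : pos_den q -> pos_den r ->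
  sqabs q (fun s => sqlt s r) = (`|val q| < val r).
Proof.
move=> hq hr; rewrite sqabsE // !sqltE // val_opp; apply/propext.
case: (lerP 0 (val q)) => h.
  by rewrite ger0_norm //; split=> [[h1 _]|E]; [exact: h1|split].
by rewrite ltr0_norm //; split=> [[_ h1]|E]; [exact: h1|split].
Qed.

Definition eventually (P : N -> Prop) : Prop :=
  exists S : N, forall n : N, inq S <= inq n -> P n.

Lemma eventually_and (P R : N -> Prop) :
  eventually P -> eventually R -> eventually (fun n => P n /\ R n).
Proof.
move=> [S hS] [S' hS']; exists (S + S') => n; rewrite inqD => h.
by split; [apply: hS|apply: hS']; have := inq_ge0 S; have := inq_ge0 S'; lra.
Qed.

Lemma eventually_mono (P R : N -> Prop) :
  (forall n, P n -> R n) -> eventually P -> eventually R.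
Proof. by move=> PR [S h]; exists S => n /h/PR. Qed.

(** Here [u] is a function outside the model, so pointwise operations such as $|x - f(x)|$ can be
    computed with even though their graphs are not given as sets. *)
Definition tracks x (u : N -> Q) : Prop :=
  (forall n, exists q, [/\ scanonical q, x n q & val q = u n]) /\
  (forall n q, scanonical q -> x n q -> val q = u n).

Lemma tracks_const p : pos_den p -> tracks (srconst p) (fun=> val p).
Proof.
move=> hp; split=> n; last by move=> q hq; rewrite /srconst sqeqE //; auto.
have [q [hq E]] := canonical_ex (val p).
by exists q; split=> //; rewrite /srconst sqeqE //; auto.
Qed.

Lemma sraddE x y n r : scanonical r -> sradd x y n r =
  exists a b, [/\ scanonical a, scanonical b, x n a, y n b & val r = val a + val b].
Proof.
move=> hr; rewrite /sradd sexQE; apply/propext; split.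
  move=> [a [ha]]; rewrite sexQE => -[b [hb]]; rewrite !sandE => -[xa [yb]].
  rewrite sqeqE ?val_add; auto => E; by exists a, b.
move=> [a [b [ha hb xa yb E]]]; exists a; split=> //; rewrite sexQE.
by exists b; rewrite !sandE; do !split=> //; rewrite sqeqE ?val_add; auto.
Qed.

Lemma sroppE x n r : scanonical r -> sropp x n r =
  exists a, [/\ scanonical a, x n a & val r = - val a].
Proof.
move=> hr; rewrite /sropp sexQE; apply/propext; split.
  move=> [a [ha]]; rewrite !sandE => -[xa].
  rewrite sqeqE ?val_opp; auto => E; by exists a.
move=> [a [ha xa E]]; exists a; split=> //.
by rewrite !sandE; do !split=> //; rewrite sqeqE ?val_opp; auto.
Qed.

Lemma srabsE x n r : scanonical r -> srabs x n r =
  exists a, [/\ scanonical a, x n a & val r = `|val a|].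
Proof.
move=> hr; rewrite /srabs sexQE; apply/propext; split.
  move=> [a [ha]]; rewrite !sandE => -[xa].
  rewrite sqabs_eqE; auto => E; by exists a.
move=> [a [ha xa E]]; exists a; split=> //.
by rewrite !sandE; do !split=> //; rewrite sqabs_eqE; auto.
Qed.

Lemma tracks_add x y u v : tracks x u -> tracks y v ->
  tracks (sradd x y) (fun n => u n + v n).
Proof.
move=> [x1 x2] [y1 y2]; split=> n.
  have [a [ha xa aE]] := x1 n; have [b [hb yb bE]] := y1 n.
  have [q [hq E]] := canonical_ex (u n + v n); exists q; split=> //.
  by rewrite sraddE //; exists a, b; rewrite aE bE.
by move=> q hq; rewrite sraddE // => -[a [b [ha hb /x2-> // /y2 -> //]]].
Qed.

Lemma tracks_opp x u : tracks x u -> tracks (sropp x) (fun n => - u n).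
Proof.
move=> [x1 x2]; split=> n.
  have [a [ha xa aE]] := x1 n.
  have [q [hq E]] := canonical_ex (- u n); exists q; split=> //.
  by rewrite sroppE //; exists a; rewrite aE.
by move=> q hq; rewrite sroppE // => -[a [ha /x2-> //]].
Qed.

Lemma tracks_abs x u : tracks x u -> tracks (srabs x) (fun n => `|u n|).
Proof.
move=> [x1 x2]; split=> n.
  have [a [ha xa aE]] := x1 n.
  have [q [hq E]] := canonical_ex `|u n|; exists q; split=> //.
  by rewrite srabsE //; exists a; rewrite aE.
by move=> q hq; rewrite srabsE // => -[a [ha /x2-> //]].
Qed.

Lemma srleE x y : srle x y = forall eps : Q, 0 < eps -> eventually (fun n =>
  exists a b, [/\ scanonical a, scanonical b, x n a, y n b & val a <= val b + eps]).
Proof.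
rewrite /srle sallQE; apply/propext; split=> [h eps eps0|h q hq].
  have [q [hq qE]] := canonical_ex eps; have := h q hq.
  rewrite sqltE ?val0 ?qE; auto => /(_ eps0); rewrite sexE => -[S hS]; exists S => n Sn.
  have := hS n; rewrite sleE => /(_ Sn); rewrite sexQE => -[a [ha]]; rewrite sexQE => -[b [hb]].
  by rewrite !sandE => -[xa [yb]]; rewrite sqleE ?val_add ?qE; auto => E; exists a, b.
rewrite sqltE ?val0; auto => /h[S hS]; rewrite sexE; exists S => n; rewrite sleE => /hS.
move=> [a [b [ha hb xa yb E]]]; rewrite sexQE; exists a; split=> //; rewrite sexQE.
by exists b; rewrite !sandE; do !split=> //; rewrite sqleE ?val_add; auto.
Qed.

Lemma srle_tracks x y u v : tracks x u -> tracks y v ->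
  srle x y = forall eps : Q, 0 < eps -> eventually (fun n => u n <= v n + eps).
Proof.
move=> [x1 x2] [y1 y2]; rewrite srleE; apply/propext; split=> h eps /h.
  by apply: eventually_mono => n [a [b [ha hb /x2-> // /y2-> //]]].
apply: eventually_mono => n uv; have [a [ha xa aE]] := x1 n; have [b [hb yb bE]] := y1 n.
by exists a, b; rewrite aE bE.
Qed.

(** Strict inequality of reals excludes equality, so being below the radius at each index is not
    enough; the margin [val d - c] does it. *)
Lemma sball_intro d y p (u : N -> Q) c : pos_den d -> scanonical p -> tracks y u ->
  c < val d -> eventually (fun n => `|u n - val p| <= c) -> sball d y p.
Proof.
move=> hd hp ty cd ev; rewrite /sball /srlt.
have t1 := tracks_abs (tracks_add ty (tracks_opp (tracks_const (canonical_pos_den hp)))).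
have t2 := tracks_const hd.
rewrite sandE /sreq; split.
  rewrite (srle_tracks t1 t2) => eps eps0; apply: eventually_mono ev => n; lra.
rewrite /sneg sandE => -[_]; rewrite (srle_tracks t2 t1).
have e0 : 0 < (val d - c) / 2 by lra.
move=> /(_ _ e0) /(eventually_and ev) [S /(_ S)]; rewrite lexx => /(_ isT).
lra.
Qed.

Lemma sball_elim d y p (u : N -> Q) : pos_den d -> scanonical p -> tracks y u ->
  sball d y p -> forall eps : Q, 0 < eps -> eventually (fun n => `|u n - val p| <= val d + eps).
Proof.
move=> hd hp ty; rewrite /sball /srlt sandE => -[h _].
have t1 := tracks_abs (tracks_add ty (tracks_opp (tracks_const (canonical_pos_den hp)))).
by move: h; rewrite (srle_tracks t1 (tracks_const hd)).
Qed.

End Spec.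

(** * Powers of two *)

Section PowersOfTwo.
Variable M : rca_model.
Local Notation N := (num M).
Implicit Types m n v w x : N.
Local Notation "x '<n' y" := (@mlt M x y) (at level 70).

(** Together with [pow2_ex] this is all that the fixed point argument uses about powers of two: the
    radii are positive and become arbitrarily small. *)
Lemma pow2_gt n v : @spow2 M n v -> inq n < inq v.
Proof.
rewrite /spow2 sexE => -[E]; rewrite !sandE => -[_ [tot [base [step nv]]]].
have [w [nw]] : exists w, mmem (npr n w) E /\ n <n w.
  elim/(@num_Sind M): n {nv} => [||n [w [nw lt]]]; first by definable.
    by exists 1; split=> //; apply/nltE; rewrite !inqE.
  exists (w * (1 + 1)); split; first exact: step.
  by apply/nltE; move/nltE/inq_lt: lt; rewrite !inqE; have := inq_ge0 n; lra.
have := tot n; rewrite sexE => -[w']; rewrite sandE => -[_ uniq].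
by rewrite (uniq _ nw) (uniq _ nv) => /nltE.
Qed.

(** The graph of the power function as a course-of-values condition; requiring [npr m w] to lie
    below [x] makes it local. *)
Definition pow2_step (Z : N -> Prop) x : Prop :=
  x = npr 0 1 \/ exists m, m <n x /\ exists w, w <n x + 1 /\
    (npr m w <n x /\ Z (npr m w) /\ x = npr (m + 1) (w * (1 + 1))).

Lemma pow2_ex n : exists v, @spow2 M n v.
Proof.
have [||E hE] := @course_of_values M pow2_step.
- have main Z Z' x : (forall y : N, y <n x -> (Z y <-> Z' y)) -> pow2_step Z x -> pow2_step Z' x.
    rewrite /pow2_step => ZZ' [->|[m [mx [w [wx [lt [Zx xE]]]]]]]; [by left|right].
    by exists m; split=> //; exists w; do !split=> //; apply/ZZ'.
  by move=> Z Z' x ZZ'; split; apply: main => // y yx; apply: iff_sym; apply: ZZ'.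
- by rewrite /pow2_step; definable; apply: Dl_el; term_definable.
have base : mmem (npr 0 1) E by apply/hE; rewrite /pow2_step; left.
have step m w : mmem (npr m w) E -> mmem (npr (m + 1) (w * (1 + 1))) E.
  move=> mw; apply/hE; rewrite /pow2_step; right; exists m.
  have lt : inq (npr m w) < inq (npr (m + 1) (w * (1 + 1))).
    by apply: npr_sum_le; rewrite !inqE; have := inq_ge0 w; lra.
  split; first by apply/nltE; apply: le_lt_trans lt; apply: npr_le1.
  exists w; split; last by split=> //; apply/nltE.
  by apply/nltSE/ltW; apply: le_lt_trans lt; apply: npr_le2.
have tot m : exists w, mmem (npr m w) E.
  elim/(@num_Sind M): m => [||m [w /step h]]; [by definable|by exists 1|].
  by exists (w * (1 + 1)).
(* The auxiliary bound [z] on both values makes the induction formula bounded. *)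
have uniq z m : forall w, w <n z -> forall w', w' <n z ->
    mmem (npr m w) E -> mmem (npr m w') E -> w' = w.
  elim/(@num_ind M): m => [||m IH w wz w' wz'].
  - by definable.
  - have h w : mmem (npr 0 w) E -> w = 1.
      move=> /hE[/npr_inj[]//|[m [_ [w' [_ [_ [_ /npr_inj[]]]]]]]].
      by move=> /esym /nS_neq0.
    by move=> w _ w' _ /h -> /h ->.
  have h v : v <n z -> mmem (npr (m + 1) v) E ->
      exists u : N, [/\ u <n z, mmem (npr m u) E & v = u * (1 + 1)].
    move=> vz /hE[/npr_inj[/nS_neq0//]|[m' [_ [u [_ [_ [mu /npr_inj[/nS_inj mE vE]]]]]]]].
    exists u; split=> //; last by rewrite mE.
    by apply/nltE; move/nltE: vz; rewrite vE !inqE; have := inq_ge0 u; lra.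
  move=> /(h _ wz)[u [uz mu ->]] /(h _ wz')[u' [uz' mu' ->]].
  by rewrite (IH _ uz _ uz' mu mu').
have [v nv] := tot n; exists v; rewrite /spow2 sexE; exists E; rewrite !sandE.
split=> [k /hE[->|[m [_ [w [_ [_ [_ ->]]]]]]]|].
- by rewrite sexE; exists (0 : N); rewrite sexE; exists (1 : N).
- by rewrite sexE; exists (m + 1 : N); rewrite sexE; exists (w * (1 + 1) : N).
split=> [m|]; last by split=> //; split=> // m w /step.
have [w mw] := tot m; rewrite sexE; exists w; rewrite sandE; split=> // w' mw'.
apply: (uniq (w + w' + 1) m) => //; apply/nltSE; rewrite inqE.
- by have := inq_ge0 w'; lra.
- by have := inq_ge0 w; lra.
Qed.

End PowersOfTwo.

(** * A maximal chain for the Caristi order *)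

Section Chain.
Variables (M : rca_model) (G : sets M).
Local Notation N := (num M).
Local Notation Q := (ratn M).
Local Notation srat := (srat M).
Implicit Types i t k m n x y : N.
Implicit Types p q r v : srat.
Local Notation "x '<n' y" := (@mlt M x y) (at level 70).

Definition code q : N := npr (npr (spos q) (sneg_part q)) (sden q).

Lemma code_inj q r : code q = code r -> q = r.
Proof. by case: q r => [a b c] [a' b' c'] /npr_inj[/npr_inj[/= -> ->] ->]. Qed.

Definition entry i p v : N := npr (npr i (code p)) (code v).

(** The counter [t] lets every triple recur at arbitrarily late positions [x]. *)
Definition decodes x p v : Prop := exists i t, x = npr (entry i p v) t.

Lemma decodes_inj x p v p' v' : decodes x p v -> decodes x p' v' -> p = p' /\ v = v'.
Proof.
move=> [i [t ->]] [i' [t' /npr_inj[/npr_inj[/npr_inj[_ /code_inj ->] /code_inj ->] _]]].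
by [].
Qed.

(** Components do not exceed their code, so decoding is a bounded search; the rationals are split
    into numbers to stay within the language. *)
Definition ex_decode x (P : srat -> srat -> Prop) : Prop :=
  exists i, i <n x + 1 /\ exists t, t <n x + 1 /\
  exists a, a <n x + 1 /\ exists b, b <n x + 1 /\ exists c, c <n x + 1 /\
  exists a', a' <n x + 1 /\ exists b', b' <n x + 1 /\ exists c', c' <n x + 1 /\
  (x = npr (entry i (@SRat M a b c) (@SRat M a' b' c')) t /\
   P (@SRat M a b c) (@SRat M a' b' c')).

Lemma npr_leL z x y : inq z <= inq x -> inq z <= inq (npr x y).
Proof. by move=> h; apply: le_trans h (npr_le1 _ _). Qed.

Lemma npr_leR z x y : inq z <= inq y -> inq z <= inq (npr x y).
Proof. by move=> h; apply: le_trans h (npr_le2 _ _). Qed.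

Lemma ex_decodeE x P : ex_decode x P <-> exists p v, decodes x p v /\ P p v.
Proof.
split.
  move=> [i [_ [t [_ [a [_ [b [_ [c [_ [a' [_ [b' [_ [c' [_ [xE Pp]]]]]]]]]]]]]]]]].
  by exists (@SRat M a b c), (@SRat M a' b' c'); split=> //; exists i, t.
move=> [[a b c] [[a' b' c'] [[i [t xE]] Pp]]].
have le z : inq z <= inq (npr (entry i (SRat a b c) (SRat a' b' c')) t) -> z <n x + 1.
  by move=> h; apply/nltSE; rewrite xE.
exists i; split; first exact/le/npr_leL/npr_leL/npr_le1.
exists t; split; first exact/le/npr_le2.
exists a; split; first exact/le/npr_leL/npr_leL/npr_leR/npr_leL/npr_le1.
exists b; split; first exact/le/npr_leL/npr_leL/npr_leR/npr_leL/npr_le2.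
exists c; split; first exact/le/npr_leL/npr_leL/npr_leR/npr_le2.
exists a'; split; first exact/le/npr_leL/npr_leR/npr_leL/npr_le1.
exists b'; split; first exact/le/npr_leL/npr_leR/npr_leL/npr_le2.
by exists c'; split; first exact/le/npr_leL/npr_leR/npr_le2.
Qed.

Definition rle_num q r : Prop :=
  mlt (madd (mmul (spos q) (sden r)) (mmul (sneg_part r) (sden q)))
    (madd (madd (mmul (spos r) (sden q)) (mmul (sneg_part q) (sden r))) (mone M)).

Lemma rle_numE q r : pos_den q -> pos_den r -> rle_num q r <-> val q <= val r.
Proof. by move=> hq hr; rewrite -(sqleE hq hr) /sqle sleE; apply: nltSE. Qed.

Hypothesis G_entry : forall k : N, mmem k G -> exists i p v,
  [/\ scanonical p, scanonical v, 0 <= val v & k = entry i p v].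
Definition valid x : Prop :=
  exists k, k <n x + 1 /\ exists t, t <n x + 1 /\ (x = npr k t /\ mmem k G).

Lemma validP x : valid x <-> exists k t, x = npr k t /\ mmem k G.
Proof.
split=> [[k [_ [t [_ h]]]]|[k [t [-> kG]]]]; first by exists k, t.
exists k; split; first by apply/nltSE/npr_le1.
by exists t; split; first by apply/nltSE/npr_le2.
Qed.

(** Validity is assumed inside the existential, with dummy data otherwise, so that choice yields
    total functions. *)
Lemma valid_data x : exists pv : srat * srat, valid x ->
  [/\ decodes x pv.1 pv.2, scanonical pv.1, scanonical pv.2 & 0 <= val pv.2].
Proof.
have [h|nh] := pselect (valid x); last by exists (sq0 M, sq0 M).
move/validP: h => [k [t [xE /G_entry[i [p [v [hp hv v0 kE]]]]]]].
by exists (p, v) => _; split=> //; exists i, t; rewrite xE kE.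
Qed.

(** The Caristi--Ekeland order, in a form without division and absolute value. *)
Definition prec x y : Prop :=
  ex_decode x (fun p v => ex_decode y (fun p' v' =>
    rle_num (sqadd (sqadd v v) (sqadd p (sqopp p'))) (sqadd v' v') /\
    rle_num (sqadd (sqadd v v) (sqadd p' (sqopp p))) (sqadd v' v'))).

Lemma precE x y p v p' v' : decodes x p v -> decodes y p' v' ->
  pos_den p -> pos_den v -> pos_den p' -> pos_den v' ->
  prec x y <-> val v + `|val p - val p'| / 2 <= val v'.
Proof.
move=> dx dy pp pv pp' pv'; rewrite /prec ex_decodeE.
have E : (rle_num (sqadd (sqadd v v) (sqadd p (sqopp p'))) (sqadd v' v') /\
          rle_num (sqadd (sqadd v v) (sqadd p' (sqopp p))) (sqadd v' v'))
    <-> val v + `|val p - val p'| / 2 <= val v'.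
  have opp q : pos_den q -> pos_den (sqopp q) by [].
  have aux := pos_den_add.
  rewrite !rle_numE ?val_add ?val_opp; auto 6.
  move: (val p) (val p') (val v) (val v') => a a' b b'.
  by split=> [[? ?]|]; case: (ger0P (a - a')) => ?; first [lra | move=> ?; split; lra].
split=> [[p1 [v1 [dp]]]|h].
  rewrite ex_decodeE => -[p2 [v2 [dp' h]]]; apply/E.
  have [-> ->] := decodes_inj dx dp; by have [-> ->] := decodes_inj dy dp'.
exists p, v; split=> //; rewrite ex_decodeE.
by exists p', v'; split=> //; apply/E.
Qed.

Lemma prec_Dl : @Dl M 2 (fun g => prec g.1 g.2.1).
Proof. rewrite /prec /ex_decode /rle_num /entry /code /=; definable. Qed.

Lemma valid_Dl : @Dl M 1 (fun g => valid g.1).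
Proof. by rewrite /valid; definable. Qed.

Definition chain_step (Z : N -> Prop) x : Prop :=
  valid x /\ forall y, y <n x -> Z y -> prec x y.

Lemma chain_ex : exists D, forall x : N, mmem x D <-> chain_step (fun y => mmem y D) x.
Proof.
apply: course_of_values.
- move=> Z Z' x ZZ'; split=> -[vx h]; split=> // y yx /(ZZ' _ yx) Zy; exact: h.
- rewrite /chain_step; definable.
  + by apply: (Dl_app1 valid_Dl); term_definable.
  + by apply: Dl_el; term_definable.
  + by apply: (Dl_app2 prec_Dl); term_definable.
Qed.

End Chain.

Lemma frac_bound (R : realFieldType) (a b c e m h : R) : 0 < c ->
  (a * e + m * c <= h * c + b * e) = ((a - b) / c * e + m <= h).
Proof.
move=> c0; rewrite -[RHS](ler_pM2r c0) mulrDl mulrAC mulfVK ?gt_eqF //.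
by apply/idP/idP; lra.
Qed.

(** * Convergence and minimality along the chain *)

Section ChainLimit.
Variables (M : rca_model) (G : sets M).
Local Notation N := (num M).
Local Notation Q := (ratn M).
Local Notation srat := (srat M).
Implicit Types i t k m n x y : N.
Implicit Types p q r v : srat.
Local Notation "x '<n' y" := (@mlt M x y) (at level 70).
Variable k0 : N.
Hypothesis k0G : mmem k0 G.
Variable D : sets M.
Hypothesis D_step : forall x : N, mmem x D <-> chain_step G (fun y => mmem y D) x.

Variables (point height : N -> srat).
Hypothesis pointP : forall x, valid G x ->
  [/\ decodes x (point x) (height x), scanonical (point x), scanonical (height x)
    & 0 <= val (height x)].
Variables pp vv : N -> Q.
Hypotheses (ppE : forall x, val (point x) = pp x) (vvE : forall x, val (height x) = vv x).

Lemma precP x y : valid G x -> valid G y -> prec x y <-> vv x + `|pp x - pp y| / 2 <= vv y.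
Proof.
move=> /pointP[dx /canonical_pos_den px /canonical_pos_den hx _].
move=> /pointP[dy /canonical_pos_den py /canonical_pos_den hy _].
by rewrite -!ppE -!vvE; apply: precE.
Qed.

Lemma nle_lt x y : inq x <= inq y -> x = y \/ x <n y.
Proof.
move=> xy; case: (nlt_total x y) => [|->|/nltE]; [by right|by left|].
by rewrite ltNge xy.
Qed.

Lemma D_valid x : mmem x D -> valid G x.
Proof. by move=> /D_step[]. Qed.

Lemma D_prec x y : mmem x D -> mmem y D -> inq y <= inq x ->
  vv x + `|pp x - pp y| / 2 <= vv y.
Proof.
move=> xD yD /nle_lt[->|yx]; first by rewrite subrr normr0 mul0r addr0.
apply/(precP (D_valid xD) (D_valid yD)).
by case/D_step: xD => _; apply.
Qed.

Lemma vv_ge0 x : mmem x D -> 0 <= vv x.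
Proof. by move=> /D_valid/pointP[_ _ _]; rewrite vvE. Qed.

Lemma D_first : exists x, mmem x D /\ forall y : N, y <n x -> ~ mmem y D.
Proof.
have [||x [xv min]] := @least M (valid G) (npr k0 0).
- exact: valid_Dl.
- by apply/validP; exists k0, 0.
exists x; split=> [|y /min ny /D_valid //]; apply/D_step; split=> // y /min ny /D_valid //.
Qed.

(** The inequality [vv x * e + m <= h] with the denominator of the height cleared, so that it is a
    bounded formula; [m] counts drops of size at least [1 / e]. *)
Definition height_below (m e h x : N) : Prop :=
  ex_decode x (fun _ v =>
    mlt (madd (mmul (spos v) e) (mmul m (sden v)))
      (madd (madd (mmul h (sden v)) (mmul (sneg_part v) e)) (mone M))).

Lemma height_belowE m e h x : mmem x D ->
  height_below m e h x <-> vv x * inq e + inq m <= inq h.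
Proof.
move=> /D_valid/pointP[dx _ /canonical_pos_den hx _].
rewrite /height_below ex_decodeE.
have E v : pos_den v -> mlt (madd (mmul (spos v) e) (mmul m (sden v)))
      (madd (madd (mmul h (sden v)) (mmul (sneg_part v) e)) (mone M))
     <-> val v * inq e + inq m <= inq h.
  move=> hv; apply: iff_trans (nltSE _ _) _.
  by rewrite !(inqD, inqM) frac_bound.
rewrite -vvE.
split=> [[p [v [dp]]]|h0]; first by have [_ <-] := decodes_inj dx dp; move/E => /(_ hx).
by exists (point x), (height x); split=> //; apply/E.
Qed.

(** Otherwise each element is followed by one lower by more than [eps], and induction on the number
    [m] of such drops gives elements with [vv x * (e + 1) + m <= h * (e + 1)]. For
    [m = h * (e + 1) + 1] the height would be negative. *)
Lemma D_drop (eps : Q) : 0 < eps -> exists x0, mmem x0 D /\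
  forall y, mmem y D -> inq x0 <= inq y -> vv x0 - vv y <= eps.
Proof.
move=> eps0; apply: contrapT => nex.
have next x : mmem x D -> exists y, mmem y D /\ vv y + eps < vv x.
  move=> xD; apply: contrapT => ny; apply: nex; exists x; split=> // y yD xy.
  by rewrite leNgt; apply/negP => lt; apply: ny; exists y; split=> //; lra.
have [e he] := archi_inv eps0; have [x1 [x1D _]] := D_first.
have [h hh] := archi_le (vv x1).
have e1 : 0 < inq (e + 1) by rewrite !inqE; have := inq_ge0 e; lra.
have main m : exists x, mmem x D /\ height_below m (e + 1) (h * (e + 1)) x.
  elim/(@num_Sind M): m => [||m [x [xD]]].
  - by rewrite /height_below /ex_decode /entry /code /=; definable.
  - exists x1; split; first exact: x1D.
    apply/(height_belowE _ _ _ x1D).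
    by rewrite inq0 addr0 (inqM h) ler_pM2r.
  - move=> /(height_belowE _ _ _ xD) hx; have [y [yD yx]] := next _ xD.
    exists y; split; first exact: yD.
    apply/(height_belowE _ _ _ yD).
    have h2 : 1 <= eps * inq (e + 1).
      by rewrite -(ler_pM2r e1) in he; rewrite -inq1 -inqD mulVf ?gt_eqF in he.
    have h3 : (vv y + eps) * inq (e + 1) <= vv x * inq (e + 1) by rewrite ler_pM2r // ltW.
    by rewrite (inqD m) inq1; lra.
have [x [xD]] := main (h * (e + 1) + 1); move=> /(height_belowE _ _ _ xD).
rewrite (inqD (h * (e + 1))) inq1; have := vv_ge0 xD => v0.
have : 0 <= vv x * inq (e + 1) by rewrite mulr_ge0 // ltW.
lra.
Qed.

(** A triple that violates the bound at [x] would have a later copy [n] below all members of the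
    chain before it. The copy would then be taken, and would drop below [vv x0] by more than
    [D_drop] allows. *)
Lemma D_min (i : N) p v (delta : Q) : mmem (entry i p v) G -> 0 < delta ->
  exists x0, mmem x0 D /\ forall x, mmem x D -> inq x0 <= inq x ->
    vv x - delta <= val v + `|val p - pp x| / 2.
Proof.
(* A member [y] after [x] costs the gap [vv x - vv y] twice, once for the height and once as a bound
   on half the distance from [x] to [y]; hence [delta / 2]. *)
move=> kG d0; have [|x0 [x0D drop]] := @D_drop (delta / 2); first lra.
exists x0; split; first exact: x0D.
move=> x xD x0x; rewrite leNgt; apply/negP => lt.
(* The counter [x + 1] places this copy of the triple after [x]. *)
have [n nE] : exists n, n = npr (entry i p v) (x + 1) by exists (npr (entry i p v) (x + 1)).
have nv : valid G n by rewrite nE; apply/validP; exists (entry i p v), (x + 1).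
have [dn _ _ _] := pointP nv.
have [pE vE] : p = point n /\ v = height n.
  by apply: decodes_inj dn; exists i, (x + 1).
rewrite pE vE ppE vvE in lt.
have xn : inq x < inq n.
  by rewrite nE; apply: lt_le_trans (npr_le2 _ _); rewrite !inqE; lra.
have nrm := normr_ge0 (pp n - pp x).
have d1 := D_prec xD x0D x0x; have nrm0 := normr_ge0 (pp x - pp x0).
suff nD : mmem n D by have d2 := drop _ nD (le_trans x0x (ltW xn)); lra.
apply/D_step; split; first exact: nv.
move=> y yn yD; apply/(precP nv (D_valid yD)).
have tri : `|pp n - pp y| <= `|pp n - pp x| + `|pp x - pp y|.
  by have := ler_normD (pp n - pp x) (pp x - pp y); rewrite addrA subrK.
have [xy|yx] := lerP (inq x) (inq y).
- have := D_prec yD xD xy; rewrite distrC => h1.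
  have := drop _ yD (le_trans x0x xy); lra.
- have := D_prec xD yD (ltW yx); lra.
Qed.

Variable n0 : N.
Hypothesis n0D : mmem n0 D.
Hypothesis n0_first : forall y : N, y <n n0 -> ~ mmem y D.

(** The latest chain element up to [s], with [n0] as default before the chain starts. This gives a
    sequence over all [s] without enumerating [D]. *)
Definition current (s l : N) : Prop :=
  (mmem l D /\ l <n s + 1 /\ forall m : N, m <n s + 1 -> mmem m D -> m <n l + 1)
  \/ (s <n n0 /\ l = n0).

Lemma current_Dl : @Dl M 2 (fun g => current g.1 g.2.1).
Proof. rewrite /current; definable. Qed.

Lemma current_ex s : exists l, l <n s + n0 + 1 /\ current s l.
Proof.
elim/(@num_ind M): s => [||s [l [lb cl]]].
- by definable; apply: (Dl_app2 current_Dl); term_definable.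
- exists n0; split; first by apply/nltSE; rewrite !inqE; lra.
  case: (nlt_total 0 n0) => [h|h|/nltn0//]; [by right|left].
  split=> //; split=> [|m lm _]; first by apply/nltSE; rewrite h.
  by rewrite -h.
- have [sD|nsD] := pselect (mmem (s + 1) D).
    exists (s + 1); split; first by apply/nltSE; rewrite !inqE; have := inq_ge0 n0; lra.
    by left; split=> //; split=> //; apply/nltSE.
  exists l; split.
    by apply/nltSE; move/nltSE: lb; rewrite !inqE; lra.
  case: cl => [[lD [ls h]]|[sn lE]].
    left; split=> //; split.
      by apply/nltSE; move/nltSE: ls; rewrite !inqE; lra.
    by move=> m /nltnS[/h //|->].
  right; split=> //; case: (nlt_total (s + 1) n0) => // [E|/nltSE h].
    by case: nsD; rewrite E.
  by move/nltE: sn; rewrite ltNge h.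
Qed.

Definition last_elt (s : N) : N := projT1 (cid (current_ex s)).

Lemma last_eltP s : current s (last_elt s).
Proof. by rewrite /last_elt; case: cid => l /= []. Qed.

Lemma current_unique s l l' : current s l -> current s l' -> l = l'.
Proof.
have h0 l1 : mmem l1 D -> l1 <n s + 1 -> s <n n0 -> False.
  move=> l1D l1s sn; apply: (n0_first _ l1D); apply/nltE.
  by move/nltE: sn; move/nltSE: l1s; lra.
case=> [[lD [ls h]]|[sn lE]]; case=> [[lD' [ls' h']]|[sn' lE']].
- have := h _ ls' lD'; have := h' _ ls lD; rewrite !nltSE => h1 h2.
  by apply: inq_inj; apply/eqP; rewrite eq_le h1 h2.
- by case: (h0 _ lD ls sn').
- by case: (h0 _ lD' ls' sn).
- by rewrite lE lE'.
Qed.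

Lemma last_elt_D s : mmem (last_elt s) D.
Proof. by case: (last_eltP s) => [[]//|[_ ->]]. Qed.

Lemma last_elt_ge s x : mmem x D -> inq x <= inq s -> inq x <= inq (last_elt s).
Proof.
move=> xD xs; case: (last_eltP s) => [[_ [_ h]]|[sn _]].
  by apply/nltSE/h => //; apply/nltSE.
by case: (n0_first (y := x)) => //; apply/nltE; move/nltE: sn; lra.
Qed.

Definition pos_at s : srat := point (last_elt s).
Definition height_at s : srat := height (last_elt s).
Local Notation u s := (pp (last_elt s)).
Local Notation w s := (vv (last_elt s)).

(** [last_elt] is chosen outside the model; uniqueness lets the bounded formula [current] replace
    it, so that comprehension yields the limit as a set of the model. *)
Lemma position_set : exists X, forall z : N, mmem z X <-> exists s, z = npr s (code (pos_at s)).
Proof.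
have [|X hX] := @Dl_comprehension M (fun z : N => exists s : N, s <n z + 1 /\
    exists l : N, l <n s + n0 + 1 /\ (current s l /\ ex_decode l (fun p _ => z = npr s (code p)))).
  rewrite /ex_decode /entry /code /=; definable.
  by apply: (Dl_app2 current_Dl); term_definable.
exists X => z; rewrite hX.
have dec s : decodes (last_elt s) (pos_at s) (height_at s).
  by case: (pointP (D_valid (last_elt_D s))).
split=> [[s [_ [l [_ [cl]]]]]|[s zE]].
  rewrite ex_decodeE (current_unique cl (last_eltP s)) => -[p [v [dp ->]]].
  by have [<- _] := decodes_inj (dec s) dp; exists s.
exists s; split; first by rewrite zE; apply/nltSE/npr_le1.
exists (last_elt s); split; first by rewrite /last_elt; case: cid => l /= [].
split; first exact: last_eltP.
by rewrite ex_decodeE; exists (pos_at s), (height_at s).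
Qed.

Lemma pos_at_canonical s : scanonical (pos_at s).
Proof. by case: (pointP (D_valid (last_elt_D s))). Qed.

Lemma height_at_canonical s : scanonical (height_at s).
Proof. by case: (pointP (D_valid (last_elt_D s))). Qed.

Lemma pos_at_entry s : exists j : N, mmem (entry j (pos_at s) (height_at s)) G.
Proof.
have h := D_valid (last_elt_D s); have [[i [t E]] _ _ _] := pointP h.
case/validP: h => k [t' [E' kG]]; exists i.
by move: E; rewrite {1}E' => /npr_inj[<-].
Qed.

Lemma pos_at_cauchy (eps : Q) : 0 < eps -> exists S, forall s s',
  inq S <= inq s -> inq S <= inq s' -> `|u s - u s'| <= eps /\ w s <= w s' + eps.
Proof.
(* A drop of at most [eps / 4] limits distances to the point of [x0] by [eps / 2], as the order
   halves distances; two of these add up to [eps]. *)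
move=> e0; have [|x0 [x0D drop]] := @D_drop (eps / 4); first lra.
have h s : inq x0 <= inq s -> `|u s - pp x0| <= eps / 2 /\ vv x0 - eps / 4 <= w s <= vv x0.
  move=> /(last_elt_ge x0D) ge.
  have := drop _ (last_elt_D s) ge; have := D_prec (last_elt_D s) x0D ge.
  have := normr_ge0 (u s - pp x0); lra.
exists x0 => s s' /h[h1 h2] /h[h3 h4]; split; last lra.
have := ler_normD (u s - pp x0) (pp x0 - u s'); rewrite addrA subrK (distrC (pp x0)); lra.
Qed.

Lemma pos_at_min (i : N) p v (delta : Q) : mmem (entry i p v) G -> 0 < delta ->
  eventually (fun s => w s - delta <= val v + `|val p - u s| / 2).
Proof.
move=> kG /(D_min kG)[S [SD hS]]; exists S => s Ss.
by apply: hS; [exact: last_elt_D|exact: last_elt_ge].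
Qed.

End ChainLimit.

(** * The limit of the chain is a fixed point *)

Section FixedPoint.
Variables (M : rca_model) (F G : sets M).
Local Notation N := (num M).
Local Notation Q := (ratn M).
Local Notation srat := (srat M).

Lemma pfun_value : sis_pfun F -> forall (q : srat) (i : N), scanonical q ->
  exists r, [/\ scanonical r, sfval F q i r
    & forall r', scanonical r' -> sfval F q i r' -> val r' = val r].
Proof.
rewrite /sis_pfun sandE sallQE => -[_ h] q i hq; have := h q hq i.
rewrite /sexuniqueQ sexQE => -[r [hr]]; rewrite sandE sallQE => -[qr uniq].
exists r; split=> // r' hr' /(uniq _ hr'); by rewrite sqeqE //; apply: canonical_pos_den.
Qed.

Lemma lsc_entry : sis_lsc G -> forall k : N, mmem k G -> exists i p v,
  [/\ scanonical p, scanonical v, 0 <= val v & k = entry i p v].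
Proof.
rewrite /sis_lsc !sandE => -[h1 [_ h3]] k kG; have := h1 k kG.
rewrite sexE => -[i]; rewrite sexQE => -[p [hp]]; rewrite sexQE => -[v [hv kE]].
exists i, p, v; split=> //; have := h3 i; rewrite sallQE => /(_ p hp).
rewrite sallQE => /(_ v hv); rewrite /sgval -kE => /(_ kG).
by rewrite sqleE ?val0 //; [apply: pos_den0|apply: canonical_pos_den].
Qed.

Lemma lsc_nonempty : sis_lsc G -> exists k : N, mmem k G.
Proof.
rewrite /sis_lsc !sandE => -[_ [h2 _]]; have [p [hp _]] := canonical_ex (0 : Q).
have := h2 (0 : N); rewrite sallQE => /(_ p hp); rewrite /sexuniqueQ sexQE => -[r [_]].
by rewrite sandE => -[h _]; exists (entry 0 p r).
Qed.

Lemma sgmin_elim (i : N) (p a : srat) (n : N) : scanonical a -> sgmin G i p n a ->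
  (exists i' : N, inq i' <= inq i /\ mmem (entry i' p a) G) /\
  (forall (i' : N) (r : srat), inq i' <= inq i -> scanonical r -> mmem (entry i' p r) G ->
     val a <= val r).
Proof.
move=> ha; rewrite /sgmin sandE sexE => -[[i']]; rewrite sandE sleE => -[ii hi] h.
split; first by exists i'.
move=> j r ji hr hj; have := h j; rewrite sleE sallQE => /(_ ji r hr hj).
by rewrite sqleE //; apply: canonical_pos_den.
Qed.

Hypothesis F_pfun : sis_pfun F.
Hypothesis G_lsc : sis_lsc G.
Variables (X : sets M) (pos_at height_at : N -> srat).
Hypothesis X_spec : forall z : N, mmem z X <-> exists s, z = npr s (code (pos_at s)).
Hypothesis pos_at_canonical : forall n, scanonical (pos_at n).
Hypothesis height_at_canonical : forall n, scanonical (height_at n).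
Hypothesis pos_at_entry : forall n, exists j : N, mmem (entry j (pos_at n) (height_at n)) G.
Variables u w : N -> Q.
Hypotheses (uE : forall n, val (pos_at n) = u n) (wE : forall n, val (height_at n) = w n).
Hypothesis u_cauchy : forall eps : Q, 0 < eps -> exists S : N, forall s s' : N,
  inq S <= inq s -> inq S <= inq s' -> `|u s - u s'| <= eps /\ w s <= w s' + eps.
Hypothesis u_min : forall (i : N) p v (delta : Q), mmem (entry i p v) G -> 0 < delta ->
  eventually (fun s => w s - delta <= val v + `|val p - u s| / 2).

Lemma X_mem n q : mmem (npr n (code q)) X <-> q = pos_at n.
Proof.
split=> [/X_spec[s /npr_inj[-> /code_inj //]]|->].
by apply/X_spec; exists n.
Qed.

Lemma tracks_X : tracks (srset X) u.
Proof.
split=> [n|n q hq /X_mem ->]; last exact: uE.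
by exists (pos_at n); split; [|apply/X_mem|exact: uE].
Qed.

Lemma tracks_fX : exists fu, tracks (sfapp F (srset X)) fu.
Proof.
have h (n : N) : exists z : Q, exists r, [/\ scanonical r, sfval F (pos_at n) n r, val r = z
    & forall r', scanonical r' -> sfval F (pos_at n) n r' -> val r' = z].
  by have [r [hr qr uniq]] := pfun_value F_pfun n (@pos_at_canonical n); exists (val r), r.
have [fu hfu] := choice h; exists fu; split=> [n|n q hq].
  have [r [hr qr rE _]] := hfu n; exists r; split=> //.
  by rewrite /sfapp sexQE; exists (pos_at n); split=> //; rewrite sandE; split=> //; apply/X_mem.
have [r [_ _ _ uniq]] := hfu n.
by rewrite /sfapp sexQE => -[q' [hq']]; rewrite sandE => -[/X_mem ->]; apply: uniq.
Qed.

Lemma fixed_point_bound fu : tracks (sfapp F (srset X)) fu ->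
  slsc_le G (sfapp F (srset X)) (srset X)
    (sropp (srabs (sradd (srset X) (sropp (sfapp F (srset X)))))) ->
  forall eps : Q, 0 < eps -> eventually (fun n => `|u n - fu n| <= eps).
Proof.
(* The errors below add up to [|u - fu| <= 4 * d + |p - u| / 2] and [|p - u| <= 2 * d + |u - fu|],
   whence [|u - fu| <= 10 * d]. *)
move=> tf H eps eps0; set d := eps / 10.
have d0 : 0 < d by rewrite /d; lra.
have [e [he eE]] := canonical_ex d; have [m hm] := archi_inv d0.
move: H; rewrite /slsc_le sallQE => /(_ e he).
rewrite sqltE ?val0 ?eE; [|exact: pos_den0|exact: canonical_pos_den].
move=> /(_ d0 m); rewrite sexE => -[n Hn].
have [v nv] := pow2_ex n.
have v0 : 0 < inq v by apply: le_lt_trans (inq_ge0 n) (pow2_gt nv).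
have r0 : 0 < (inq v)^-1 by rewrite invr_gt0.
have [S1 cauchy1] := u_cauchy d0.
have [|S2 cauchy2] := u_cauchy (eps := (inq v)^-1 / 2); first lra.
pose S := S1 + S2.
have S1S : inq S1 <= inq S by rewrite inqD; have := inq_ge0 S2; lra.
have S2S : inq S2 <= inq S by rewrite inqD; have := inq_ge0 S1; lra.
(* The hypothesis on [g] is used at the chain point of a late stage [S], which lies in the required
   ball around the limit; there the minimum up to [j] is at most the height [w S]. *)
have [j jG] := pos_at_entry S.
have := Hn j; rewrite sallQE => /(_ (pos_at S) (@pos_at_canonical S)).
have in_ball : sball2 n (srset X) (pos_at S).
  rewrite /sball2 sexE; exists v; rewrite sandE; split=> //.
  apply: (sball_intro (c := (inq v)^-1 / 2) _ (@pos_at_canonical S) tracks_X).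
  - exact: v0.
  - by rewrite val_inv /ival; lra.
  - by exists S2 => s hs; rewrite uE; case: (cauchy2 s S hs S2S).
move=> /(_ in_ball); rewrite sexE => -[i]; rewrite sexQE => -[p [hp]].
rewrite sandE /sball2 sexE => -[[v']]; rewrite sandE => -[nv' pball] le.
have v'm := pow2_gt nv'.
have v'0 : 0 < inq v' by apply: le_lt_trans (inq_ge0 m) v'm.
have v'd : (inq v')^-1 <= d.
  apply: le_trans hm; rewrite lef_pV2 ?posrE //; first exact: inq_lt.
  by have := inq_ge0 m; lra.
have near_p := sball_elim (d := sqinv v') v'0 hp tf pball d0.
have tz := tracks_opp (tracks_abs (tracks_add tracks_X (tracks_opp tf))).
move: le; rewrite srleE => /(_ _ d0) le.
(* The minimum [a] is an actual value of the family at [p], so [u_min] will apply to it. It is read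
   off at one index; the entry [a'] found at any other index is also such a value, hence not below
   [a]. *)
have [a [ha aG a_le]] : exists a, [/\ scanonical a, exists i' : N, mmem (entry i' p a) G
    & eventually (fun s => val a <= w S - `|u s - fu s| + 2 * d)].
  case: le => S3 le; have [a [_ [ha _ amin _ _]]] := le S3 (lexx _).
  have [[i' [_ i'G]] a_min] := sgmin_elim ha amin; exists a; split=> //; first by exists i'.
  exists S3 => s /le[a' [b [ha' hb a'min]]]; rewrite sraddE // => -[b1 [c1 [hb1 hc1]]].
  rewrite sraddE // => -[g1 [z1 [hg1 hz1 gmin /(proj2 tz _ _ hz1) z1E b1E]]].
  rewrite /srconst sqeqE ?eE; [|exact: canonical_pos_den|exact: canonical_pos_den].
  move=> c1E bE ab.
  have [[i2 [i2i i2G]] _] := sgmin_elim ha' a'min.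
  have aa' := a_min _ _ i2i ha' i2G.
  have [_ /(_ _ _ (lexx _) (@height_at_canonical S) jG)] := sgmin_elim hg1 gmin.
  rewrite wE; move: ab aa'; rewrite bE b1E z1E c1E; lra.
case: aG => i' i'G; have a_min := u_min i'G d0.
have tail : eventually (fun s => w S <= w s + d).
  by exists S1 => s hs; case: (cauchy1 S s S1S hs).
apply: eventually_mono (eventually_and (eventually_and near_p a_le) (eventually_and a_min tail)).
move=> s [[h1 h2] [h3 h4]]; move: h1; rewrite val_inv /ival => h1.
have := ler_normD (val p - fu s) (fu s - u s).
rewrite addrA subrK (distrC (val p) (fu s)) (distrC (fu s) (u s)) => tri.
move: h1 h2 h3 h4 tri v'd; rewrite /d.
move: (`|u s - fu s|) (`|fu s - val p|) (`|val p - u s|) => x y z; lra.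
Qed.

Lemma X_real : sis_real X.
Proof.
rewrite /sis_real /sis_seq !sandE; split; first split.
- move=> k /X_spec[s ->]; rewrite sexE; exists s; rewrite sexQE.
  by exists (pos_at s).
- move=> n; rewrite /sexuniqueQ sexQE; exists (pos_at n); split=> //.
  rewrite sandE sallQE; split; first exact/X_mem.
  by move=> r hr /X_mem ->; rewrite /sqeq.
rewrite sallQE => e he; rewrite sqltE ?val0; [|exact: pos_den0|exact: canonical_pos_den].
move=> e0; have [|S hS] := u_cauchy (eps := val e / 2); first lra.
rewrite sexE; exists S => m n; rewrite !sleE => Sm Sn; rewrite sexQE.
exists (pos_at m); split=> //; rewrite sexQE; exists (pos_at n); split=> //.
rewrite !sandE; split; first exact/X_mem.
split; first exact/X_mem.
have [pm pn] := (canonical_pos_den (@pos_at_canonical m), canonical_pos_den (@pos_at_canonical n)).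
rewrite sqabs_ltE ?val_add ?val_opp //; [|exact: pos_den_add|exact: canonical_pos_den].
rewrite !uE; have [h _] := hS _ _ Sm Sn; move: h; rewrite -/(`|u m - u n|); lra.
Qed.

End FixedPoint.

Theorem caristi_in_model (M : rca_model) : caristi_statement M.
Proof.
move=> F G; rewrite /scontinuous !sandE => -[F_pfun _] [G_lsc _] H.
have entries := lsc_entry G_lsc; have [k0 k0G] := lsc_nonempty G_lsc.
have [D hD] := chain_ex G.
have [n0 [n0D n0_first]] := D_first k0G hD.
have [pv hpv] := choice (valid_data entries).
pose point x := (pv x).1; pose height x := (pv x).2.
have hp x : valid G x -> [/\ decodes x (point x) (height x), scanonical (point x),
    scanonical (height x) & 0 <= val (height x)] := hpv x.
pose pp x := val (point x); pose vv x := val (height x).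
have ppE x : val (point x) = pp x by [].
have vvE x : val (height x) = vv x by [].
have [X hX] := position_set hD hp n0D n0_first.
have pos_can s : scanonical (pos_at point n0D s) by exact: (pos_at_canonical hD hp).
have height_can s : scanonical (height_at height n0D s) by exact: (height_at_canonical hD hp).
have pos_ent := pos_at_entry hD hp n0D.
have cauchy := pos_at_cauchy k0G hD hp ppE vvE n0D n0_first.
have u_min := pos_at_min k0G hD hp ppE vvE n0D n0_first.
have X_real := X_real hX pos_can (fun n => ppE _) cauchy.
have [fu tf] := tracks_fX F_pfun hX pos_can.
have tX := tracks_X hX pos_can (fun n => ppE _).
have near := fixed_point_bound hX pos_can height_can pos_ent (fun n => ppE _)
  (fun n => vvE _) cauchy u_min tf (H X X_real).
rewrite sexE; exists X; rewrite sandE; split; first exact: X_real.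
rewrite /sreq sandE (srle_tracks tf tX) (srle_tracks tX tf).
by split=> eps /near; apply: eventually_mono => n; rewrite ler_norml; lra.
Qed.

End Caristi.

From Pilot Require Import Defs.

Theorem theorem7p22 :
  provable RCA0
    (sentence
      (ALLSET F G,
        continuous_on_R F ==>
        is_lsc G /\ finite_valued G ==>
        (ALLR x, lsc_le G (fapp F x) x (-R rabs (x -R fapp F x))) ==>
        EXR x, fapp F x =R x)%SO).
Proof.
apply Caristi.completeness; intros M rcaM r q.
(* Satisfaction of the sentence unfolds to [caristi_statement] by conversion; the given assignment
   supplies the default set [q 0]. *)
exact (@Caristi.caristi_in_model (Caristi.RcaModel (q 0) rcaM)).
Qed.
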